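(* Let $G$ be a graph of order $n\geq 4$ such that both $G$ and its complement $\overline{G}$ are connected. Then: $md(G)\cdot md(\overline{G})=9$ if $n=4$; $4\leq md(G)\cdot md(\overline{G})\leq 9$ if $n=5$; $3\leq md(G)\cdot md(\overline{G})\leq 10$ if $n=6$; and $1\leq md(G)\cdot md(\overline{G})\leq 2(n-1)$ if $n\geq 7$. Furthermore, the bounds are sharp, i.e., for each such $n$ each of the stated lower and upper bounds is attained by some graph $G$ of order $n$ with $G$ and $\overline{G}$ connected.
   Context: Graphs are finite and simple. An edge-coloring of a graph $G$ is an arbitrary map from $E(G)$ to a finite set of colors (adjacent edges may receive the same color). For two distinct vertices $u,v$ of an edge-colored graph $G$, a monochromatic $uv$-cut is a set $M$ of edges, all of the same color, such that $u$ and $v$ lie in different components of $G-M$. An edge-coloring of $G$ is an $MD$-coloring (monochromatic disconnection coloring) if every two distinct vertices of $G$ are separated by a monochromatic cut. For a connected graph $G$, the monochromatic disconnection number $md(G)$ is the maximum number of colors actually used on $E(G)$ over all $MD$-colorings of $G$. *)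

(* Defs.v *)
From mathcomp Require Import all_boot.
From mathcomp Require Import boolp.

Set Implicit Arguments.
Unset Strict Implicit.
Unset Printing Implicit Defensive.

Record sgraph := SGraph {
  vertex :> finType;
  adj : rel vertex;
  adj_sym : symmetric adj;
  adj_irrefl : irreflexive adj }.

Section Complement.
Variable G : sgraph.

Definition compl_adj : rel G := [rel x y | (x != y) && ~~ adj x y].

Lemma compl_adj_sym : symmetric compl_adj.
Proof. by move=> x y; rewrite /compl_adj /= eq_sym adj_sym. Qed.

Lemma compl_adj_irrefl : irreflexive compl_adj.
Proof. by move=> x; rewrite /compl_adj /= eqxx. Qed.

Definition compl : sgraph := SGraph compl_adj_sym compl_adj_irrefl.
End Complement.

Definition connected (G : sgraph) : Prop := forall x y : G, connect (@adj G) x y.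

Definition edges (G : sgraph) : {set {set G}} :=
  [set [set p.1; p.2] | p : G * G & adj p.1 p.2].

(* Adjacency in G - M. *)
Definition del_adj (G : sgraph) (M : {set {set G}}) : rel G :=
  [rel x y | adj x y && ([set x; y] \notin M)].

(* An edge-coloring is given by a total map on {set G}; only its values on
   edges G are ever used. *)
Section Coloring.
Variables (G : sgraph) (C : finType) (c : {set G} -> C).

Definition mono_cut (u v : G) (M : {set {set G}}) : Prop :=
  [/\ M \subset edges G,
      {in M &, forall e f, c e = c f}
    & ~~ connect (del_adj M) u v].

Definition MD_coloring : Prop :=
  forall u v : G, u != v -> exists M : {set {set G}}, mono_cut u v M.

Definition colors_used : nat := #|[set c e | e in edges G]|.
End Coloring.

Definition MD_colorable_with (G : sgraph) (k : nat) : Prop :=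
  exists (C : finType) (c : {set G} -> C), MD_coloring c /\ colors_used c = k.

(* The range of k loses nothing: a coloring uses at most #|edges G| colors.
   See md_max and md_attained. *)
Definition md (G : sgraph) : nat :=
  \max_(k < #|edges G|.+1 | `[< MD_colorable_with G k >]) k.

Lemma md_max (G : sgraph) (C : finType) (c : {set G} -> C) :
  MD_coloring c -> colors_used c <= md G.
Proof.
move=> hc; have lt_k : colors_used c < #|edges G|.+1 by rewrite ltnS leq_imset_card.
apply: (@leq_bigmax_cond _ _ (fun k : 'I__ => k : nat) (Ordinal lt_k)).
by apply/asboolP; exists C, c.
Qed.

Lemma md_attained (G : sgraph) : MD_colorable_with G (md G).
Proof.
pose c (_ : {set G}) := tt.
have hc : MD_coloring c.
  move=> u v neq_uv; exists (edges G); split=> //.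
  apply/connectP => -[[|x p] /=]; first by move=> _ e; rewrite e eqxx in neq_uv.
  by case/andP=> /andP[a_ux] /imsetP[]; exists (u, x); rewrite ?inE.
have lt_k : colors_used c < #|edges G|.+1 by rewrite ltnS leq_imset_card.
have hk : `[< MD_colorable_with G (Ordinal lt_k) >]
  by apply/asboolP; exists unit, c.
rewrite /md (bigmax_eq_arg _ hk).
by case: arg_maxnP => [|i /asboolP].
Qed.

Definition md_product_attained (n k : nat) : Prop :=
  exists G : sgraph,
    [/\ #|G| = n, connected G, connected (compl G) & md G * md (compl G) = k].

(* Main.v *)
Require Import Defs.
From mathcomp Require Import all_boot.
From mathcomp Require Import zify.

(* An MD-colouring with k colours is the same as an embedding of the graph into
   a product of k complete graphs: coordinate i of a vertex is its component
   after deleting colour i, so distinct vertices have distinct coordinates and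
   an edge of colour i changes exactly coordinate i. Hence md G is the largest
   number of nonconstant coordinates of such an embedding, and md G <= n - 1.

   Upper bound: for n >= 5, if md G and md (compl G) are both at least 3, then
   both are at most 3. Embed G and its complement and let W be a longest line
   (vertices differing in one coordinate only), say in the complement. A vertex
   outside W with two complement neighbours in W would lie on W, so in G it is
   adjacent to all but at most one vertex of W. Two outside vertices thus have
   many common neighbours, and K_{2,3} and triangles of G lie on lines of G,
   which are no longer than W. If at most two vertices lie outside W, both
   embeddings have at most three nonconstant coordinates; otherwise this leaves
   only configurations in which one of them has at most two. If no line has three vertices, both graphs are triangle-free,
   hence 5-cycles, where every colour occurs twice.

   Lower bounds for n = 4, 5, 6: a search over all graphs finds explicit
   coordinates. *)

Set Implicit Arguments.
Unset Strict Implicit.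
Unset Printing Implicit Defensive.

(** * Graphs in products of complete graphs *)

Section Hamming.
Variables (V I : finType) (X : eqType) (f : V -> I -> X).

Definition line i u v := [forall (j | j != i), f u j == f v j].

Definition varying := [set i | [exists u, exists v, f u i != f v i]].

(** By injectivity two distinct vertices lie on at most one line, so the direction of an edge is
    determined and can serve as its colour. *)
Definition hamming (e : rel V) :=
  (forall u v, (forall i, f u i = f v i) -> u = v) /\
  (forall u v, e u v -> exists i, line i u v).

Lemma lineP i u v : reflect (forall j, j != i -> f u j = f v j) (line i u v).
Proof. by apply: (iffP forall_inP) => h j ji; apply/eqP; rewrite ?h. Qed.

Lemma line_refl i u : line i u u.
Proof. exact/lineP. Qed.

Lemma line_sym i u v : line i u v = line i v u.
Proof. by apply/lineP/lineP => h j /h. Qed.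

Lemma line_trans i u v w : line i u v -> line i v w -> line i u w.
Proof. by move=> /lineP h /lineP h'; apply/lineP => j ji; rewrite h ?h'. Qed.

Lemma varyingPn i : reflect (forall u v, f u i = f v i) (i \notin varying).
Proof.
rewrite inE negb_exists; apply: (iffP forallP) => h u.
  by move=> v; have := h u; rewrite negb_exists => /forallP/(_ v); rewrite negbK => /eqP.
by rewrite negb_exists; apply/forallP => v; rewrite (h u v) eqxx.
Qed.

Lemma card_varying_le (S : seq I) x0 :
  (forall i u, i \notin S -> f u i = f x0 i) -> #|varying| <= size S.
Proof.
move=> h; apply: leq_trans (card_size S).
apply/subset_leq_card/subsetP => i; apply: contraTT => iS.
by apply/varyingPn => u v; rewrite h // [f v i]h.
Qed.

End Hamming.

Lemma connect_exit (V : finType) (e : rel V) (A : pred V) x y :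
  connect e x y -> A x -> ~~ A y -> exists u v, [/\ A u, ~~ A v & e u v].
Proof.
move=> /connectP[p ep ->]; elim: p x ep => [|z p IH] x /=.
  by move=> _ ->.
case/andP=> exz ep Ax nA; case Az: (A z); first exact: (IH z).
by exists x, z; rewrite Az.
Qed.

Lemma del_adj_sym (G : sgraph) (M : {set {set G}}) : symmetric (del_adj M).
Proof. by move=> u v; rewrite /del_adj /= adj_sym setUC. Qed.

Lemma edge_in (G : sgraph) (u v : G) : adj u v -> [set u; v] \in edges G.
Proof. by move=> uv; apply/imsetP; exists (u, v); rewrite ?inE. Qed.

Lemma set2_eq (T : finType) (u v x y : T) :
  [set u; v] = [set x; y] -> (u = x /\ v = y) \/ (u = y /\ v = x).
Proof.
move=> /setP h; have := h u; have := h v; have := h x; have := h y.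
rewrite !inE !eqxx ?orbT /= => hy hx hv hu.
case/orP: (esym hu) => /eqP eu; subst.
  left; split=> //; case/orP: (esym hv) => /eqP // ev; subst.
  by move: hy; rewrite orbb => /eqP ->.
right; split=> //; case/orP: (esym hv) => /eqP // ev; subst.
by move: hx; rewrite orbb => /eqP ->.
Qed.

(** Take an optimal colouring and let coordinate [i] of [u] be the root of its component after
    deleting every edge of colour [i]. An edge survives the deletion of any other colour, so it
    changes at most its own coordinate. *)
Lemma md_hamming (G : sgraph) : connected G ->
  exists (I : finType) (f : G -> I -> G), hamming f (@adj G) /\ #|varying f| = md G.
Proof.
move=> conG; have [C [c [mdc <-]]] := md_attained G.
pose E i := [set e in edges G | c e == i].
pose f u i := root (del_adj (E i)) u.
have fP i u v : (f u i == f v i) = connect (del_adj (E i)) u v.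
  by apply: root_connect; apply: sym_connect_sym; apply: del_adj_sym.
(* Enlarging a cut to all edges of its colour keeps it a cut. *)
have sep i u v (M : {set {set G}}) : M \subset edges G -> {in M, forall e, c e = i} ->
    ~~ connect (del_adj M) u v -> f u i != f v i.
  move=> sM cM; rewrite fP; apply: contra; apply: connect_sub => x y.
  case/andP=> xy nE; apply: connect1; rewrite /del_adj /= xy /=.
  by apply: contra nE => xyM; rewrite inE edge_in //= cM.
(* A cut between the ends of an edge must contain that edge, hence has its colour. *)
have sepE u v : adj u v -> f u (c [set u; v]) != f v (c [set u; v]).
  move=> uv; have neq : u != v by apply: contraTneq uv => ->; rewrite adj_irrefl.
  have [M [sM cM nc]] := mdc u v neq.
  have inM : [set u; v] \in M.
    by apply: contraNT nc => nM; apply: connect1; rewrite /del_adj /= uv.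
  by apply: sep nc => // x xM; apply: cM.
exists C, f; split; first split.
- move=> u v fuv; apply/eqP; apply: contraTT isT => neq.
  have [M [sM cM nc]] := mdc u v neq.
  have [M0|[x xM]] := set_0Vmem M.
    case/negP: nc; apply: connect_sub (conG u v) => a b ab; apply: connect1.
    by rewrite /del_adj /= ab M0 inE.
  have := sep (c x) u v M sM (fun e eM => cM e x eM xM) nc.
  by rewrite fuv eqxx.
- move=> u v uv; exists (c [set u; v]); apply/lineP => j ji; apply/eqP.
  rewrite fP; apply: connect1; rewrite /del_adj /= uv inE edge_in //=.
  by rewrite eq_sym.
apply: eq_card => i; rewrite inE; apply/existsP/imsetP => [[u /existsP[v]]|[e]].
  rewrite fP => nc; have := conG u v.
  (* A varying coordinate is a colour in use: some edge leaves the component of [u], so it was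
     deleted. *)
  have [u' [v' [_ _ /andP[u'v']]]] : exists a b, [/\ connect (del_adj (E i)) u a,
      ~~ connect (del_adj (E i)) u b & adj a b && ~~ del_adj (E i) a b].
    have [a [b [ca cb ab]]] := connect_exit (conG u v) (connect0 _ u) nc.
    exists a, b; split=> //; rewrite ab /=; apply: contra cb => d.
    exact: connect_trans ca (connect1 d).
  rewrite /del_adj /= u'v' /= negbK inE => /andP[h1 /eqP h2] _.
  by exists [set u'; v'].
case/imsetP=> -[u v]; rewrite inE /= => uv -> ->.
by exists u; apply/existsP; exists v; apply: sepE.
Qed.

(** Colour each edge by the coordinate it changes. Two vertices differing in coordinate [i] are
    separated by colour [i], because every path between them changes that coordinate somewhere; for
    the same reason every varying coordinate is a colour in use. *)
Lemma hamming_md (G : sgraph) (I : finType) (X : eqType) (f : G -> I -> X) :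
  connected G -> hamming f (@adj G) -> #|varying f| <= md G.
Proof.
move=> conG [inj edge].
(* [None] is the value on sets that are not edges. *)
pose c (S : {set G}) := [pick i | [exists u, exists v,
  [&& S == [set u; v], adj u v & f u i != f v i]]].
have cE u v i : adj u v -> f u i != f v i -> c [set u; v] = Some i.
  move=> uv fuv; rewrite /c; case: pickP => [j /=|/(_ i) /= /negbT/negP[]]; last first.
    by apply/existsP; exists u; apply/existsP; exists v; rewrite eqxx uv.
  case/existsP=> x /existsP[y /and3P[/eqP/set2_eq E xy fj]].
  have [k /lineP uvk] := edge u v uv.
  have fj' : f u j != f v j by case: E => [[-> ->]|[-> ->]] //; rewrite eq_sym.
  have -> : i = k by apply/eqP; apply: contraNT fuv => /uvk ->.
  by congr Some; apply/eqP; apply: contraNT fj' => /uvk ->.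
have mdc : MD_coloring c.
  move=> u v neq; have [i fi] : exists i, f u i != f v i.
    apply/existsP; apply: contraNT neq; rewrite negb_exists => /forallP h.
    by apply/eqP/inj => i; apply/eqP; rewrite -[_ == _]negbK.
  exists [set x in edges G | c x == Some i]; split.
  - by apply/subsetP => x; rewrite inE => /andP[].
  - by move=> x y; rewrite !inE => /andP[_ /eqP ->] /andP[_ /eqP ->].
  apply/negP => uv; have nv : ~~ (f v i == f u i) by rewrite eq_sym.
  have [a [b [/eqP fa fb /andP[ab]]]] :=
    connect_exit (A := fun x => f x i == f u i) uv (eqxx _) nv.
  by rewrite inE edge_in //= (cE a b i) ?eqxx // fa eq_sym.
apply: leq_trans (md_max mdc).
rewrite {mdc} /colors_used -(card_imset _ (@Some_inj _)).
apply/subset_leq_card/subsetP => o /imsetP[i]; rewrite inE => /existsP[u].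
case/existsP=> v fuv ->.
have nv : ~~ (f v i == f u i) by rewrite eq_sym.
have [a [b [/eqP fa fb ab]]] :=
  connect_exit (A := fun x => f x i == f u i) (conG u v) (eqxx _) nv.
by apply/imsetP; exists [set a; b]; rewrite ?edge_in // (cE a b i) // fa eq_sym.
Qed.

(** * Triangles, 4-cycles and [K_{2,3}] in an embedded graph *)

Section Lines.
Variables (V I : finType) (X : eqType) (f : V -> I -> X) (e : rel V).
Hypotheses (e_irr : irreflexive e) (hf : hamming f e).

Lemma edge_line u v : e u v -> exists i, line f i u v.
Proof. exact: hf.2. Qed.

Lemma edge_neq u v : e u v -> u != v.
Proof. by apply: contraTneq => ->; rewrite e_irr. Qed.

Lemma line_coord_eq i u v : line f i u v -> f u i = f v i -> u = v.
Proof.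
move=> /lineP h fi; apply: hf.1 => j.
by have [->//|ji] := eqVneq j i; apply: h.
Qed.

Lemma line_inj i j u v : i != j -> line f i u v -> line f j u v -> u = v.
Proof. by move=> ij h /lineP h'; apply: line_coord_eq h _; apply: h'. Qed.

(** If neither edge at [u] had direction [i], then [x] and [y] would both agree with [u] in
    coordinate [i] and so coincide. *)
Lemma edge_two_line i u x y :
  x != y -> line f i x y -> e u x -> e u y -> line f i u x.
Proof.
move=> nxy xy /edge_line[j ux] /edge_line[k uy].
have [<- //|ji] := eqVneq j i.
have [ki|ki] := eqVneq k i.
  by rewrite -ki; apply: line_trans uy _; rewrite line_sym ki.
case/eqP: nxy; apply: line_coord_eq xy _.
by rewrite -(lineP _ _ _ _ ux) 1?eq_sym // (lineP _ _ _ _ uy) // eq_sym.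
Qed.

(** Coordinate [m] can differ between [x] and [y] only if both edges at [y] have direction [m]. Then
    [u] and [u'] lie on a line of direction [m], while the path through [x] changes only [i] and
    [j]. *)
Lemma square_coords i j u u' x y m :
    u != u' -> e u x -> e u' x -> e u y -> e u' y ->
    line f i u x -> line f j u' x -> m != i -> m != j -> f y m = f x m.
Proof.
move=> nuu' ux u'x /edge_line[p uy] /edge_line[q u'y] li lj mi mj.
have fu : f u m = f x m by apply: (lineP _ _ _ _ li).
have fu' : f u' m = f x m by apply: (lineP _ _ _ _ lj).
have [mp|mp] := eqVneq m p; last by rewrite -(lineP _ _ _ _ uy).
have [mq|mq] := eqVneq m q; last by rewrite -(lineP _ _ _ _ u'y).
have muu' : line f m u u'.
  by rewrite {1}mp in uy *; apply: line_trans uy _; rewrite -mp mq line_sym.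
have [ij|ij] := eqVneq i j.
  case/eqP: nuu'; apply: line_inj mi muu' _.
  by apply: line_trans li _; rewrite line_sym ij.
suff : u = x by move/eqP; rewrite (negPf (edge_neq ux)).
apply: line_coord_eq li _.
by rewrite (lineP _ _ _ _ muu') 1?eq_sym // (lineP _ _ _ _ lj).
Qed.

(** Opposite edges of the 4-cycle are parallel. A change of coordinate [i] along [u x] must be
    undone at [y], and likewise for [j]; the pairing with parallel edges at [u] and at [u'] would
    put [x] and [y] on two different lines. *)
Lemma square_line i j u u' x y :
    i != j -> x != y -> e u x -> e u' x -> e u y -> e u' y ->
    line f i u x -> line f j u' x -> line f j u y /\ line f i u' y.
Proof.
move=> ij nxy ux u'x uy u'y li lj.
have [p lp] := edge_line uy; have [q lq] := edge_line u'y.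
have pi : (i == p) || (i == q).
  apply: contraTT isT; rewrite negb_or => /andP[ip iq].
  suff : u = x by move/eqP; rewrite (negPf (edge_neq ux)).
  apply: line_coord_eq li _.
  by rewrite (lineP _ _ _ _ lp) // -(lineP _ _ _ _ lq) // (lineP _ _ _ _ lj).
have pj : (j == p) || (j == q).
  apply: contraTT isT; rewrite negb_or => /andP[jp jq].
  suff : u' = x by move/eqP; rewrite (negPf (edge_neq u'x)).
  apply: line_coord_eq lj _.
  by rewrite (lineP _ _ _ _ lq) // -(lineP _ _ _ _ lp) // (lineP _ _ _ _ li) // eq_sym.
case/orP: pi => /eqP ei; case/orP: pj => /eqP ej; subst=> //.
- by rewrite eqxx in ij.
- case/eqP: nxy; apply: (line_inj ij).
    by apply: line_trans lp; rewrite line_sym.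
  by apply: line_trans lq; rewrite line_sym.
- by rewrite eqxx in ij.
Qed.

(** If the edges at [a] had different directions, [b] and [c] would both be the fourth corner of the
    same parallelogram. *)
Lemma k23_line u u' a b c :
    uniq [:: a; b; c] -> {in [:: a; b; c], forall x, e u x && e u' x} ->
  exists i, line f i u u'.
Proof.
rewrite /= !inE negb_or andbT => /andP[/andP[ab ac] bc] h.
have /andP[ua u'a] : e u a && e u' a by apply: h; rewrite !inE eqxx.
have /andP[ub u'b] : e u b && e u' b by apply: h; rewrite !inE eqxx orbT.
have /andP[uc u'c] : e u c && e u' c by apply: h; rewrite !inE eqxx !orbT.
have [i li] := edge_line ua; have [j lj] := edge_line u'a.
have [ij|ij] := eqVneq i j.
  by exists i; apply: line_trans li _; rewrite line_sym ij.
have [b1 b2] := square_line ij ab ua u'a ub u'b li lj.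
have [c1 c2] := square_line ij ac ua u'a uc u'c li lj.
case/eqP: bc; apply: (line_inj ij).
  by apply: line_trans c2; rewrite line_sym.
by apply: line_trans c1; rewrite line_sym.
Qed.

Lemma card_line_ge i x (S : {set V}) :
  {in S, forall y, line f i x y} -> #|S| <= #|[set y | line f i x y]|.
Proof. by move=> h; apply/subset_leq_card/subsetP => y /h; rewrite inE. Qed.

End Lines.

(** * The longest line *)

Section Agree.
Variables (V I : finType) (X : eqType) (f : V -> I -> X) (e : rel V).
Hypotheses (e_irr : irreflexive e) (hf : hamming f e).

(** The list [S] collects the directions used so far. Once all vertices agree outside [S], at most
    [size S] coordinates vary. *)
Definition agree (S : seq I) u v := forall m, m \notin S -> f u m = f v m.

Lemma agree_sym S u v : agree S u v -> agree S v u.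
Proof. by move=> h m /h. Qed.

Lemma agree_trans S u v w : agree S u v -> agree S v w -> agree S u w.
Proof. by move=> h h' m mS; rewrite h ?h'. Qed.

Lemma line_agree (S : seq I) i u v : i \in S -> line f i u v -> agree S u v.
Proof. by move=> iS /lineP h m mS; apply: h; apply: contraNneq mS => ->. Qed.

Lemma agree_line (S : seq I) i u v :
  u != v -> line f i u v -> agree S u v -> i \in S.
Proof.
move=> nuv l a; apply: contraNT nuv => iS.
by apply/eqP/(line_coord_eq hf l)/a.
Qed.

(** The directions of [u x] and [u' x] lie in [S], and the fourth corner [y] of the 4-cycle brings
    in no new one. *)
Lemma square_agree S u u' x y : u != u' ->
  e u x -> e u' x -> e u y -> e u' y ->
  agree S u x -> agree S u' x -> agree S y x.
Proof.
move=> nuu' ux u'x uy u'y a a' m mS.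
have [i li] := edge_line hf ux; have [j lj] := edge_line hf u'x.
apply: (square_coords e_irr hf nuu' ux u'x uy u'y li lj).
  by apply: contraNneq mS => ->; apply: agree_line li a; apply: edge_neq ux.
by apply: contraNneq mS => ->; apply: agree_line lj a'; apply: edge_neq u'x.
Qed.

End Agree.

(* The two colourings are the embeddings [f] of [e] and [g] of its complement
   [e'], and [W] is a longest line among all lines of [f] and [g], taken in
   [g]. A vertex outside [W] has at most one [e']-neighbour in [W] (its set
   [miss]), hence is [e]-adjacent to the rest of [W]. *)
Section Core.
Variables (V I J : finType) (X Y : eqType) (f : V -> I -> X) (g : V -> J -> Y).
Variables e e' : rel V.
Hypotheses (e_sym : symmetric e) (e_irr : irreflexive e).
Hypotheses (e'_sym : symmetric e') (e'_irr : irreflexive e').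
Hypotheses (hf : hamming f e) (hg : hamming g e').
Hypothesis e'E : forall u v, u != v -> e' u v = ~~ e u v.
Hypothesis con' : forall x y, connect e' x y.
Variables (a : J) (x0 : V) (W : {set V}).
Hypothesis WE : forall y, (y \in W) = line g a x0 y.
Hypothesis maxW : forall i x, #|[set y | line f i x y]| <= #|W|.
Hypothesis W3 : 2 < #|W|.

Let miss u := [set w in W | e' u w].
Let common u u' := [set w in W | e u w && e u' w].
Let inside (U : {set V}) := [rel x y | [&& x \in U, y \in U & e' x y]].

Lemma line_W w w' : w \in W -> w' \in W -> line g a w w'.
Proof.
by rewrite !WE => h h'; apply: line_trans h'; rewrite line_sym.
Qed.

Lemma missP u w : reflect (w \in W /\ e' u w) (w \in miss u).
Proof. by rewrite inE; apply: andP. Qed.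

Lemma miss_uniq u w w' : u \notin W -> w \in miss u -> w' \in miss u -> w = w'.
Proof.
move=> uW /missP[wW uw] /missP[w'W uw'].
apply/eqP; apply: contraNT uW => nww'; rewrite WE.
have := edge_two_line hg nww' (line_W wW w'W) uw uw'.
by rewrite line_sym; apply: line_trans; move: wW; rewrite WE.
Qed.

Lemma card_miss u : u \notin W -> #|miss u| <= 1.
Proof. by move=> uW; apply/card_le1_eqP => x y xm ym; apply: (@miss_uniq u). Qed.

Lemma W_neq u w : u \notin W -> w \in W -> u != w.
Proof. by move=> uW wW; apply: contraNneq uW => ->. Qed.

Lemma adj_W u w : u \notin W -> w \in W -> w \notin miss u -> e u w.
Proof.
by move=> uW wW; rewrite inE wW /= e'E ?negbK // W_neq.
Qed.

Lemma W_cover u u' : u \notin W -> u' \notin W ->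
  W \subset common u u' :|: (miss u :|: miss u').
Proof.
move=> uW u'W; apply/subsetP => w wW; rewrite inE orbC -implyNb.
apply/implyP; rewrite inE negb_or => /andP[m m'].
by rewrite inE wW !adj_W.
Qed.

Lemma commonP u u' w :
  reflect [/\ w \in W, e u w & e u' w] (w \in common u u').
Proof. by rewrite inE; apply: and3P. Qed.

Lemma card_common_ge u u' : u \notin W -> u' \notin W ->
  #|W| <= #|common u u'| + (#|miss u| + #|miss u'|).
Proof.
move=> uW u'W; apply: leq_trans (subset_leq_card (W_cover uW u'W)) _.
apply: leq_trans (leq_card_setU _ _) _; rewrite leq_add2l.
exact: leq_card_setU.
Qed.

(** An edge, or a [K_{2,3}] with three common neighbours, puts [u] and [u'] on a line; every common
    neighbour then has two neighbours on it and joins it. *)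
Lemma common_line u u' : u \notin W -> u' \notin W -> u != u' ->
    e u u' || (2 < #|common u u'|) ->
  exists i, line f i u u' /\ {in common u u', forall w, line f i u w}.
Proof.
move=> uW u'W nuu' h; have [i li] : exists i, line f i u u'.
  case/orP: h => [|/card_gt2P]; first exact: edge_line.
  case=> x [y [z [[/commonP[_ ux u'x] /commonP[_ uy u'y] /commonP[_ uz u'z]] []]]].
  move=> xy yz zx; apply: (k23_line e_irr hf (a := x) (b := y) (c := z)).
    by rewrite /= !inE negb_or xy yz eq_sym zx.
  by move=> t; rewrite !inE => /or3P[] /eqP ->; apply/andP.
exists i; split=> // w /commonP[_ uw u'w].
by rewrite line_sym; apply: (edge_two_line hf nuu' li); rewrite e_sym.
Qed.

(** The line through [u], [u'] and their common neighbours has at most [#|W|] vertices, so at least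
    two vertices of [W] are not common neighbours. Each of [u] and [u'] misses at most one, hence
    both miss one, and different ones. *)
Lemma common_small u u' : u \notin W -> u' \notin W -> u != u' ->
    e u u' || (2 < #|common u u'|) ->
  #|common u u'|.+2 = #|W| /\
  exists w w', [/\ w \in miss u, w' \in miss u' & w != w'].
Proof.
move=> uW u'W nuu' h; have [i [li lc]] := common_line uW u'W nuu' h.
have le : #|common u u'|.+2 <= #|W|.
  apply: leq_trans (maxW i u).
  apply: (@leq_trans #|u |: (u' |: common u u')|).
    rewrite !cardsU1 !inE (negPf nuu') (negPf uW) (negPf u'W) /=.
    by rewrite add1n add1n.
  apply: card_line_ge => y; rewrite !inE => /or3P[/eqP->|/eqP->//|yc].
    exact: line_refl.
  by apply: lc; rewrite inE.
have ge := card_common_ge uW u'W.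
have := card_miss uW; have := card_miss u'W => m' m.
have [mm|[w wm]] := set_0Vmem (miss u).
  by move: ge; rewrite mm cards0; lia.
have [mm|[w' wm']] := set_0Vmem (miss u').
  by move: ge; rewrite mm cards0; lia.
split; first lia.
exists w, w'; split=> //; apply: contraTneq isT => eww'; subst w'.
have : #|W| <= #|common u u'| + #|[set w]|.
  apply: leq_trans (leq_card_setU _ _); apply: subset_leq_card.
  apply: subset_trans (W_cover uW u'W) _; apply: setUS.
  apply/subsetP => y; rewrite in_setU in_set1 => /orP[] ym; apply/eqP.
    exact: (@miss_uniq u).
  exact: (@miss_uniq u').
by rewrite cards1; lia.
Qed.

(* An [e']-edge [u v] outside [W] closes a cycle through [W] in which the colour
   of [W] occurs once among the edges from [u] and [v] to [W]; so these two edges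
   have the same colour. *)
Lemma two_coords (U : {set V}) :
    {in U, forall u, u \notin W} ->
    {in U, forall u, exists w, w \in miss u} ->
    {in U &, forall u v, connect (inside U) u v} ->
  exists c, {in W :|: U, forall x, agree g [:: a; c] x x0}.
Proof.
move=> UW Um cU; have inW c w : w \in W -> agree g [:: a; c] w x0.
  by rewrite WE line_sym => l; apply: line_agree l; rewrite inE eqxx.
have [U0|[u0 u0U]] := set_0Vmem U.
  by exists a => x; rewrite U0 setU0; apply: inW.
have [w0 /missP[w0W uw0]] := Um u0 u0U; have [c lc] := edge_line hg uw0.
exists c; have neqa u w i : u \in U -> w \in W -> line g i u w -> i != a.
  move=> uU wW li; apply: contraNneq (UW u uU) => ia; rewrite WE.
  move: wW; rewrite WE => h; apply: line_trans h _.
  by rewrite line_sym -ia.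
have ca := neqa _ _ _ u0U w0W lc.
suff H u : u \in U -> exists2 w, w \in W & line g c u w.
  move=> x; rewrite inE => /orP[|/H[w wW lw]]; first exact: inW.
  apply: agree_trans (inW c w wW); apply: line_agree lw.
  by rewrite !inE eqxx orbT.
move=> uU; have /connectP[p pp ->] := cU _ _ u0U uU.
elim: p u0 w0 u0U w0W uw0 lc pp {uU ca} => [|v p IH] {}u w uU wW uw lc /=.
  by exists w.
case/andP=> /and3P[_ vU uv] pp; have [w' /missP[w'W vw']] := Um v vU.
suff lvw' : line g c v w' by apply: IH vU w'W vw' lvw' pp.
have ca' := neqa _ _ _ uU wW lc.
have [d ld] := edge_line hg vw'; have da := neqa _ _ _ vU w'W ld.
(* If the directions differed, both coordinates [c] and [d] would change along the single edge
   [u v]. *)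
have [<- //|dc] := eqVneq d c.
have [b lb] := edge_line hg uv.
have lww' := line_W wW w'W.
have gc : g u c != g v c.
  apply: contraTneq isT => gc; move: uw; suff -> : u = w by rewrite e'_irr.
  apply: (line_coord_eq hg lc); rewrite gc (lineP _ _ _ _ ld) 1?eq_sym //.
  by rewrite (lineP _ _ _ _ lww').
have gd : g u d != g v d.
  apply: contraTneq isT => gd; move: vw'; suff -> : v = w' by rewrite e'_irr.
  apply: (line_coord_eq hg ld); rewrite -gd (lineP _ _ _ _ lc) //.
  by rewrite (lineP _ _ _ _ lww').
have bc : c == b by apply: contraNT gc => cb; rewrite (lineP _ _ _ _ lb).
have bd : d == b by apply: contraNT gd => db; rewrite (lineP _ _ _ _ lb).
by case/eqP: dc; rewrite (eqP bc) (eqP bd).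
Qed.

Lemma agree_le (I' : finType) (X' : eqType) (h : V -> I' -> X') S x :
  (forall u, agree h S u x) -> #|varying h| <= size S.
Proof. by move=> hS; apply: (card_varying_le (x0 := x)) => i u; apply: hS. Qed.

Lemma varying_g_le2 (U : {set V}) :
    (forall x, x \notin W -> x \in U) ->
    {in U, forall u, u \notin W} ->
    {in U, forall u, exists w, w \in miss u} ->
    {in U &, forall u v, connect (inside U) u v} ->
  #|varying g| <= 2.
Proof.
move=> WU UW Um cU; have [c ac] := two_coords UW Um cU.
apply: (agree_le (S := [:: a; c])) => x; apply: ac.
rewrite inE orbC -implyNb; apply/implyP.
by have := @WU x; case: (x \in W) => // /(_ isT) ->.
Qed.

Lemma miss_none u w : u \notin W -> miss u = set0 -> w \in W -> e u w.
Proof. by move=> uW m0 wW; rewrite adj_W // m0 inE. Qed.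

(** * Exactly two vertices outside the longest line *)

Section TwoOutside.
Variables u u' : V.
Hypotheses (uW : u \notin W) (u'W : u' \notin W) (nuu' : u != u').
Hypothesis out : forall x, [|| x \in W, x == u | x == u'].

Lemma common_ex : exists x, x \in common u u'.
Proof.
have := card_common_ge uW u'W; have := card_miss uW; have := card_miss u'W.
have [->|[x xc] _ _ _] := set_0Vmem (common u u'); last by exists x.
by rewrite cards0; lia.
Qed.

(** For [f], take the direction of the line through [u], [u'] and their common neighbours, and those
    of the two edges reaching the missed vertices. For [g], take the direction of [W] and those of
    the [e']-edges from [u] and [u'] into [W]. *)
Lemma two_outside_adj : e u u' -> #|varying f| <= 3 /\ #|varying g| <= 3.
Proof.
move=> uu'; have h : e u u' || (2 < #|common u u'|) by rewrite uu'.
have [_ [w [w' [wm w'm nww']]]] := common_small uW u'W nuu' h.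
have [i [li lc]] := common_line uW u'W nuu' h.
have /missP[wW uw] := wm; have /missP[w'W u'w'] := w'm.
have [j lj] : exists j, line f j u' w.
  apply: (edge_line hf); apply: adj_W => //.
  by apply: contraNN nww' => m; apply/eqP/(@miss_uniq u').
have [k lk] : exists k, line f k u w'.
  apply: (edge_line hf); apply: adj_W => //.
  by apply: contraNN nww' => m; apply/eqP/(@miss_uniq u).
have [c lc'] := edge_line hg uw; have [d ld] := edge_line hg u'w'.
split.
  have au' : agree f [:: i; j; k] u' u.
    by apply/agree_sym/(line_agree _ li); rewrite !inE eqxx.
  apply: (agree_le (S := [:: i; j; k]) (x := u)) => x.
  have [xW|/orP[/eqP->//|/eqP->//]] := orP (out x).
  have := subsetP (W_cover uW u'W) x xW; rewrite !in_setU => /or3P[xc|xm|xm].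
  - by apply/agree_sym/(line_agree _ (lc x xc)); rewrite !inE eqxx.
  - rewrite (miss_uniq uW xm wm); apply: agree_trans au'.
    by apply/agree_sym/(line_agree _ lj); rewrite !inE eqxx orbT.
  - rewrite (miss_uniq u'W xm w'm).
    by apply/agree_sym/(line_agree _ lk); rewrite !inE eqxx !orbT.
have inW y : y \in W -> agree g [:: a; c; d] y x0.
  by rewrite WE line_sym => l; apply: line_agree l; rewrite inE eqxx.
apply: (agree_le (S := [:: a; c; d]) (x := x0)) => x.
have [xW|/orP[/eqP->|/eqP->]] := orP (out x); first exact: inW.
  by apply: agree_trans (inW w wW); apply: line_agree lc'; rewrite !inE eqxx orbT.
by apply: agree_trans (inW w' w'W); apply: line_agree ld; rewrite !inE eqxx !orbT.
Qed.

(** For [f], common neighbours are fourth corners of 4-cycles over [u x u'], and the one vertex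
    missed by [u] is reached from [u']. For [g], [u] hangs on [W] and [u'] hangs on [u]. *)
Lemma two_outside_full :
  ~~ e u u' -> miss u' = set0 -> #|varying f| <= 3 /\ #|varying g| <= 3.
Proof.
move=> uu' m0; have e'uu' : e' u u' by rewrite e'E.
have [x xc] := common_ex; have /commonP[xW ux u'x] := xc.
(* Otherwise no [e']-edge would leave the pair [u], [u']. *)
have [w wm] : exists w, w \in miss u.
  have nxA : ~~ pred2 u u' x by rewrite /= !(eq_sym x) !(negPf (W_neq _ xW)).
  have [y [z [yA zA yz]]] := connect_exit (A := pred2 u u') (con' u x) (predU1l _ erefl) nxA.
  have zW : z \in W by have := out z; move: zA => /= /norP[/negPf-> /negPf->]; rewrite !orbF.
  case/orP: yA => /eqP ey; subst y; first by exists z; apply/missP.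
  suff : z \in miss u' by rewrite m0 inE.
  exact/missP.
have /missP[wW uw] := wm.
have [i li] := edge_line hf ux; have [j lj] := edge_line hf u'x.
have [k lk] := edge_line hf (miss_none u'W m0 wW).
have [c lc] := edge_line hg uw; have [d ld] := edge_line hg e'uu'.
split.
  have au : agree f [:: i; j; k] u x by apply: line_agree li; rewrite !inE eqxx.
  have au' : agree f [:: i; j; k] u' x by apply: line_agree lj; rewrite !inE eqxx orbT.
  apply: (agree_le (S := [:: i; j; k]) (x := x)) => y.
  have [yW|/orP[/eqP->//|/eqP->//]] := orP (out y).
  have := subsetP (W_cover uW u'W) y yW.
  rewrite !in_setU m0 in_set0 orbF => /orP[/commonP[_ uy u'y]|ym].
    exact: (square_agree e_irr hf nuu' ux u'x uy u'y au au').
  rewrite (miss_uniq uW ym wm); apply: agree_trans au'.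
  by apply/agree_sym/(line_agree _ lk); rewrite !inE eqxx !orbT.
have inW y : y \in W -> agree g [:: a; c; d] y x0.
  by rewrite WE line_sym => l; apply: line_agree l; rewrite inE eqxx.
have au : agree g [:: a; c; d] u x0.
  by apply: agree_trans (inW w wW); apply: line_agree lc; rewrite !inE eqxx orbT.
apply: (agree_le (S := [:: a; c; d]) (x := x0)) => y.
have [yW|/orP[/eqP->//|/eqP->]] := orP (out y); first exact: inW.
by apply: agree_trans au; apply/agree_sym/(line_agree _ ld); rewrite !inE eqxx !orbT.
Qed.

End TwoOutside.

(** If both outside vertices are [e']-adjacent and miss a vertex, or only one vertex is outside,
    then [varying_g_le2] contradicts the hypothesis on [g]. *)
Lemma few_outside : #|~: W| <= 2 -> 2 < #|varying g| ->
  #|varying f| <= 3 /\ #|varying g| <= 3.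
Proof.
rewrite leq_eqVlt => /orP[/cards2P[u [u' [nuu' CW]]] g3|C1 g3].
  have uW : u \notin W by rewrite -in_setC CW !inE eqxx.
  have u'W : u' \notin W by rewrite -in_setC CW !inE eqxx orbT.
  have out x : [|| x \in W, x == u | x == u'].
    by rewrite -implyNb -in_setC CW !inE; apply/implyP.
  have [uu'|uu'] := boolP (e u u'); first exact: (two_outside_adj uW u'W nuu' out).
  have [m0'|[w' wm']] := set_0Vmem (miss u').
    exact: (two_outside_full uW u'W nuu' out).
  have [m0|[w wm]] := set_0Vmem (miss u).
    apply: (two_outside_full u'W uW) => //; rewrite 1?eq_sym 1?e_sym //.
    by move=> x; rewrite [(x == u') || _]orbC.
  suff : #|varying g| <= 2 by rewrite leqNgt g3.
apply: (@varying_g_le2 (~: W)).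
  - by move=> x; rewrite inE.
  - by move=> x; rewrite inE.
  - by move=> x; rewrite CW !inE => /orP[] /eqP->; [exists w|exists w'].
  have e'uu' : e' u u' by rewrite e'E.
  move=> x y; rewrite CW !inE => /orP[] /eqP-> /orP[] /eqP->; rewrite ?connect0 //.
    by apply: connect1; rewrite /= !inE !eqxx orbT.
  by apply: connect1; rewrite /= !inE !eqxx orbT e'_sym.
suff : #|varying g| <= 2 by rewrite leqNgt g3.
apply: (@varying_g_le2 (~: W)).
- by move=> x; rewrite inE.
- by move=> x; rewrite inE.
- move=> x xC; have xW : x \notin W by rewrite -in_setC.
  have /card_gt0P[w0 w0W] : 0 < #|W| by apply: leq_trans W3.
  have nA : ~~ (w0 \in ~: W) by rewrite inE negbK.
  have [y [z [yC zC yz]]] := connect_exit (A := mem (~: W)) (con' x w0) xC nA.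
  exists z; apply/missP; split; first by move: zC => /=; rewrite inE negbK.
  by rewrite (card_le1_eqP C1 y x yC xC).
by move=> x y xC yC; rewrite (card_le1_eqP C1 x y xC yC) connect0.
Qed.

Lemma other_outside u v : 2 < #|~: W| ->
  exists z, [/\ z \notin W, z != u & z != v].
Proof.
move=> C3; suff /card_gt0P[z] : 0 < #|(~: W) :\ u :\ v|.
  by rewrite !inE => /and3P[zv zu zW]; exists z.
have := cardsD1 u (~: W); have := cardsD1 v ((~: W) :\ u).
by case: (_ \in _); case: (_ \in _); lia.
Qed.

(** A vertex missing nothing would share at least three neighbours in [W] with any other outside
    vertex, and [common_small] then makes it miss one. *)
Lemma miss_ex u : 2 < #|~: W| -> 3 < #|W| -> u \notin W ->
  exists w, w \in miss u.
Proof.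
move=> C3 W4 uW; have [z [zW zu _]] := other_outside u u C3.
have [m0|[w wm]] := set_0Vmem (miss u); last by exists w.
have := card_common_ge uW zW; have := card_miss zW; rewrite m0 cards0 => mz ge.
have h : e u z || (2 < #|common u z|) by apply/orP; right; lia.
rewrite eq_sym in zu.
have [_ [w [w' [wm _ _]]]] := common_small uW zW zu h.
by exists w; rewrite -m0.
Qed.

(** It remains to see that the outside is connected in [e']: two [e]-adjacent outside vertices are
    joined in [e'] through any third one. *)
Lemma long_line_g_le2 : 2 < #|~: W| -> 3 < #|W| -> #|varying g| <= 2.
Proof.
move=> C3 W4; apply: (@varying_g_le2 (~: W)) => [x|x|x|u v].
- by rewrite inE.
- by rewrite inE.
- by rewrite inE; apply: miss_ex.
rewrite !inE => uW vW; have [->|nuv] := eqVneq u v; first exact: connect0.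
have [uv|uv] := boolP (e u v); last first.
  by apply: connect1; rewrite /= !inE uW vW e'E.
have h : e u v || (2 < #|common u v|) by rewrite uv.
have [cW _] := common_small uW vW nuv h; have [i [li lc]] := common_line uW vW nuv h.
have [z [zW zu zv]] := other_outside u v C3.
(* The line through [u], [v] and their common neighbours already has [#|W|] vertices. *)
have zl : ~~ line f i u z.
  apply/negP => lz; have := maxW i u; rewrite leqNgt => /negP[].
  rewrite -cW; apply: (@leq_trans #|z |: (u |: (v |: common u v))|).
    rewrite !cardsU1 !inE (negPf nuv) (negPf zu) (negPf zv).
    by rewrite (negPf uW) (negPf vW) (negPf zW).
  apply: card_line_ge => y; rewrite !inE => /or4P[/eqP->//|/eqP->|/eqP->//|yc].
    exact: line_refl.
  by apply: lc; rewrite inE.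
(* There are at least two common neighbours, and [z] misses at most one. *)
have [c cc zc] : exists2 c, c \in common u v & e z c.
  have := card_miss zW; have : 1 < #|common u v| by lia.
  case/card_gt1P=> c [d [cc dc ncd]] mz.
  have [cm|cm] := boolP (c \in miss z); last first.
    by exists c => //; apply: adj_W => //; case/commonP: cc.
  exists d => //; apply: adj_W => //; first by case/commonP: dc.
  by apply: contraNN ncd => dm; apply/eqP/(@miss_uniq z).
have /commonP[cW' uc vc] := cc; have lic := lc c cc.
(* A second [e]-neighbour on the line would pull [z] onto it. *)
have nzx x : line f i u x -> x != c -> ~~ e z x.
  move=> lx xc; apply: contra zl => zx.
  apply: line_trans (lx) _; rewrite line_sym.
  apply: (edge_two_line hf xc _ zx zc).
  by apply: (line_trans _ lic); rewrite line_sym.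
have zu' : e' u z.
  by rewrite e'_sym e'E // nzx ?line_refl // W_neq.
have zv' : e' z v by rewrite e'E // nzx // W_neq.
apply: (connect_trans (y := z)); apply: connect1; rewrite /= !inE.
  by rewrite uW zW zu'.
by rewrite vW zW zv'.
Qed.

(** * A longest line with exactly three vertices *)

Section ShortLine.
Hypotheses (C3 : 2 < #|~: W|) (cW : #|W| = 3).

Lemma miss_both u u' w w' x : u \notin W -> u' \notin W ->
    w \in miss u -> w' \in miss u' -> x \in W ->
  [\/ x \in common u u', x = w | x = w'].
Proof.
move=> uW u'W wm wm' xW; have := subsetP (W_cover uW u'W) x xW.
rewrite !in_setU => /or3P[|h|h]; first by constructor 1.
  by constructor 2; apply: (@miss_uniq u).
by constructor 3; apply: (@miss_uniq u').
Qed.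

Lemma adj_other u w x :
  u \notin W -> w \in miss u -> x \in W -> x != w -> e u x.
Proof.
move=> uW wm xW nxw; apply: adj_W => //.
by apply: contraNN nxw => xm; apply/eqP/(@miss_uniq u).
Qed.

(** Here [W] consists of the common neighbour [x] of [u] and [v], the vertex [p] missed by [u] and
    the vertex [p'] missed by [v]. All other outside vertices miss [x], hence are [e]-adjacent to
    [p] and [p']. The directions of [u v] and [z v] then reach every vertex through triangles and
    4-cycles. *)
Lemma disconnected_outside u v z :
    (forall x, x \notin W -> exists w, w \in miss x) ->
    u \notin W -> v \notin W -> z \notin W -> z != u -> z != v ->
    ~~ connect (inside (~: W)) u v -> e z v ->
  #|varying f| <= 2.
Proof.
move=> Um uW vW zW zu zv nc zv'.
have nuv : u != v by apply: contraNneq nc => ->; apply: connect0.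
have uv : e u v.
  by apply: contraNT nc => uv; apply: connect1; rewrite /= !inE uW vW e'E.
have h : e u v || (2 < #|common u v|) by rewrite uv.
have [cc [p [p' [pm pm' npp']]]] := common_small uW vW nuv h.
have [i [li lc]] := common_line uW vW nuv h.
have /card_gt0P[x xc] : 0 < #|common u v| by move: cc; rewrite cW => -[->].
have /commonP[xW ux vx] := xc.
have [[pW up] [p'W vp']] := (missP _ _ pm, missP _ _ pm').
have far y : y \notin W -> y != u -> y != v -> ~~ line f i u y.
  move=> yW yu yv; apply/negP => ly; have := maxW i u.
  rewrite cW leqNgt => /negP[]; apply: (@leq_trans #|[set u; v; x; y]|).
    rewrite -setUA cardsU !cards2 nuv [x == y]eq_sym (W_neq yW xW).
    rewrite (_ : _ :&: _ = set0) ?cards0 //; apply/setP => t; rewrite !inE.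
    apply: contraFF (erefl false) => /andP[/orP[]/eqP-> /orP[]/eqP e1]; move: yu yv uW vW;
      by rewrite -?e1 ?e1 ?eqxx ?xW.
  apply: card_line_ge => t; rewrite !inE -!orbA => /or4P[]/eqP->//.
    exact: line_refl.
  exact: lc.
(* If [y] were [e]-adjacent to [x], an [e]-edge to [u] or [v] would put it on their line; without
   one, [y] would join [u] to [v] in [e']. *)
have xmiss y : y \notin W -> y != u -> y != v -> x \in miss y.
  move=> yW yu yv; apply: contraTT isT => nxm.
  have yx := adj_W yW xW nxm; have := far y yW yu yv.
  have luy t : line f i u t -> t != x -> e y t -> line f i u y.
    move=> lt tx yt; apply: line_trans (lt) _; rewrite line_sym.
    apply: (edge_two_line hf tx _ yt yx).
    by apply: (line_trans _ (lc _ xc)); rewrite line_sym.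
  case yu' : (e y u); first by rewrite (luy u) ?line_refl // W_neq.
  case yv' : (e y v); first by rewrite (luy v) // W_neq.
  case/negP: nc; apply: (connect_trans (y := y)); apply: connect1; rewrite /= !inE.
    by rewrite uW yW e'_sym e'E // yu'.
  by rewrite vW yW e'E // yv'.
have px : p != x by apply: contraTneq up => ->; rewrite e'E ?ux // W_neq.
have p'x : p' != x by apply: contraTneq vp' => ->; rewrite e'E ?vx // W_neq.
have adjp y : y \notin W -> y != u -> y != v -> e y p /\ e y p'.
  by move=> yW yu yv; split; apply: adj_other (xmiss _ yW yu yv) _ _.
have [j lj] := edge_line hf zv'; set S := [:: i; j].
have Si : i \in S by rewrite inE eqxx.
have Sj : j \in S by rewrite !inE eqxx orbT.
have au : agree f S u v := line_agree Si li.
have az : agree f S z v := line_agree Sj lj.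
have [zp zp'] := adjp z zW zu zv.
have vp : e v p by apply: adj_other pm' _ _.
have up' : e u p' by apply: adj_other pm _ _; rewrite // eq_sym.
have ap : agree f S p v.
  apply: agree_trans az; apply: (line_agree Sj).
  by apply: (edge_two_line hf zv lj); rewrite e_sym.
have ap' : agree f S p' v.
  by apply: (square_agree e_irr hf _ uv zv' up' zp' au az); rewrite eq_sym.
apply: (agree_le (S := S) (x := v)) => y.
have [yW|yW] := boolP (y \in W).
  have [yc|->//|->//] := miss_both uW vW pm pm' yW.
  by apply: agree_trans au; apply/agree_sym/(line_agree Si)/lc.
have [->//|yu] := eqVneq y u; have [->//|yv] := eqVneq y v.
have [yp yp'] := adjp y yW yu yv.
(* [y] is the fourth corner of the 4-cycle [z p y p']. *)
apply: agree_trans (az); apply: (square_agree e_irr hf npp'); rewrite 1?e_sym //.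
  exact: agree_trans ap (agree_sym az).
exact: agree_trans ap' (agree_sym az).
Qed.

(** If the outside is disconnected in [e'], a third outside vertex cannot be [e']-adjacent to both
    separated vertices, so it is [e]-adjacent to one of them. *)
Lemma no_full_outside : (forall x, x \notin W -> exists w, w \in miss x) ->
  #|varying f| <= 2 \/ #|varying g| <= 2.
Proof.
move=> Um.
have [/forall_inP h|] := boolP [forall u in ~: W, forall v in ~: W, connect (inside (~: W)) u v].
  right; apply: (@varying_g_le2 (~: W)) => x; rewrite ?inE //; first exact: Um.
  by move=> y xC; apply: (forall_inP (h x _)); rewrite inE.
rewrite negb_forall_in => /exists_inP[u uC].
rewrite negb_forall_in => /exists_inP[v vC nc]; left.
rewrite !inE in uC vC.
have [z [zW zu zv]] := other_outside u v C3.
case zv' : (e z v); first exact: (disconnected_outside Um uC vC zW).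
case zu' : (e z u).
  apply: (disconnected_outside Um vC uC zW) => //.
  rewrite sym_connect_sym // => x y; rewrite /= e'_sym.
  by rewrite [in RHS]andbCA.
case/negP: nc; apply: (connect_trans (y := z)); apply: connect1; rewrite /= !inE.
  by rewrite uC zW e'_sym e'E // zu'.
by rewrite vC zW e'E // zv'.
Qed.

(** The other outside vertices are all [e']-adjacent to [v] and miss pairwise different vertices of
    [W]. If they are connected in [e'], [two_coords] bounds [g]; if not, the directions of an
    [e]-edge [u u'] between separated ones and of an edge at [v] bound [f]. *)
Lemma full_outside v : v \notin W -> miss v = set0 ->
  #|varying f| <= 2 \/ #|varying g| <= 2.
Proof.
move=> vW m0; have evW w : w \in W -> e v w by apply: miss_none.
have com u : u \notin W -> u != v ->
    ~~ (e v u || (2 < #|common v u|)) /\ exists w, w \in miss u.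
  move=> uW uv; have vu : v != u by rewrite eq_sym.
  have nh : ~~ (e v u || (2 < #|common v u|)).
    apply/negP => h; have [_ [w [_ [wm _ _]]]] := common_small vW uW vu h.
    by rewrite m0 inE in wm.
  split=> //; move: nh; rewrite negb_or -leqNgt => /andP[_ le].
  have [mu|[w wm]] := set_0Vmem (miss u); last by exists w.
  by have := card_common_ge vW uW; rewrite m0 mu cards0 cW; lia.
have e'v u : u \notin W -> u != v -> e' v u.
  move=> uW uv; have [] := com u uW uv; rewrite negb_or => /andP[nvu _] _.
  by rewrite e'E // eq_sym.
(* Otherwise [v], [u], [u'] are common neighbours of the other two vertices [b], [c] of [W], and the
   [K_{2,3}] puts the four vertices [v], [u], [b], [c] on one line. *)
have typ u u' w : u \notin W -> u' \notin W -> u != v -> u' != v -> u != u' ->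
    w \in miss u -> w \notin miss u'.
  move=> uW u'W uv u'v nuu' wm; apply/negP => wm'.
  have [wW _] := missP _ _ wm.
  have /cards2P[b [c [nbc Wbc]]] : #|W :\ w| == 2.
    by have := cardsD1 w W; rewrite wW cW; lia.
  have [bW bw] : b \in W /\ b != w.
    have : b \in W :\ w by rewrite Wbc !inE eqxx.
    by rewrite !inE => /andP[].
  have [cW' cw] : c \in W /\ c != w.
    have : c \in W :\ w by rewrite Wbc !inE eqxx orbT.
    by rewrite !inE => /andP[].
  have adj3 y : y \in [:: v; u; u'] -> e b y && e c y.
    rewrite !inE e_sym [e c y]e_sym.
    by move=> /or3P[] /eqP->; rewrite ?evW ?(adj_other _ wm) ?(adj_other _ wm').
  have [i li] : exists i, line f i b c.
    apply: (k23_line e_irr hf _ adj3).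
    by rewrite /= !inE negb_or ![v == _]eq_sym uv u'v nuu'.
  have := maxW i b; rewrite cW leqNgt => /negP[].
  apply: (@leq_trans #|[set v; u] :|: [set b; c]|).
    rewrite cardsU !cards2 [v == u]eq_sym uv nbc (_ : _ :&: _ = set0) ?cards0 //.
    apply/setP => t; rewrite !inE; apply: contraFF (erefl false).
    by case/andP=> /orP[]/eqP-> /orP[]/eqP e1; move: vW uW; rewrite e1 ?bW ?cW'.
  have lv y : y \in [:: v; u; u'] -> line f i b y.
    move=> /adj3/andP[by' cy]; rewrite line_sym; apply: (edge_two_line hf nbc li); rewrite e_sym //.
  apply: card_line_ge => y; rewrite !inE -!orbA => /or4P[]/eqP->//; rewrite ?line_refl //.
    by apply: lv; rewrite !inE eqxx.
  by apply: lv; rewrite !inE eqxx orbT.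
pose U := ~: W :\ v.
have UP y : y \in U = (y \notin W) && (y != v) by rewrite !inE andbC.
have [/forall_inP h|] := boolP [forall u in U, forall u' in U, connect (inside U) u u'].
  right; have [c ac] : exists c, {in W :|: U, forall x, agree g [:: a; c] x x0}.
    apply: two_coords.
    - by move=> x; rewrite UP => /andP[].
    - by move=> x; rewrite UP => /andP[xW xv]; case: (com x xW xv).
    by move=> x y xU yU; apply: (forall_inP (h x _)).
  apply: (agree_le (S := [:: a; c]) (x := x0)) => y.
  have [yWU|] := boolP (y \in W :|: U); first exact: ac.
  rewrite in_setU UP negb_or negb_and negbK => /andP[yW].
  rewrite (negPf yW) /= negbK => /eqP->.
  (* [U] contains an [e']-edge [u b]; it forms a triangle with [v], so [v] lies on its line. *)
  have [u [uW uv _]] := other_outside v v C3.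
  have [u' [u'W u'v u'u]] := other_outside v u C3.
  have uU : u \in U by rewrite UP uW.
  have u'U : u' \in U by rewrite UP u'W.
  have [s [b [su bu /and3P[_ bU ub]]]] :=
    connect_exit (A := pred1 u) (forall_inP (h u uU) u' u'U) (eqxx u) u'u.
  rewrite (eqP su) in ub; have [d ld] := edge_line hg ub.
  move: (bU); rewrite UP => /andP[bW bv].
  have aub : agree g [:: a; c] u b.
    apply: agree_trans (ac u _) (agree_sym (ac b _)); by rewrite in_setU ?uU ?bU orbT.
  have dS : d \in [:: a; c].
    by apply: (agree_line hg _ ld aub); rewrite eq_sym.
  apply: agree_trans (ac u _); last by rewrite in_setU uU orbT.
  apply: (line_agree dS); apply: (edge_two_line hg _ ld); rewrite ?e'v //.
  by rewrite eq_sym.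
rewrite negb_forall_in => /exists_inP[u uU].
rewrite negb_forall_in => /exists_inP[u' u'U nc]; left.
have nuu' : u != u' by apply: contraNneq nc => ->; apply: connect0.
have uu' : e u u'.
  by apply: contraNT nc => uu'; apply: connect1; rewrite /= uU u'U e'E.
rewrite !UP in uU u'U; have [[uW uv] [u'W u'v]] := (andP uU, andP u'U).
have h : e u u' || (2 < #|common u u'|) by rewrite uu'.
have [cc [w [w' [wm wm' nww']]]] := common_small uW u'W nuu' h.
have [i [li lc]] := common_line uW u'W nuu' h.
have [[wW uw] [w'W u'w']] := (missP _ _ wm, missP _ _ wm').
have /card_gt0P[x xc] : 0 < #|common u u'| by move: cc; rewrite cW => -[->].
have /commonP[xW ux u'x] := xc.
have [j lj] := edge_line hf (evW x xW); set S := [:: i; j].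
have Si : i \in S by rewrite inE eqxx.
have Sj : j \in S by rewrite !inE eqxx orbT.
have au : agree f S u x := line_agree Si (lc x xc).
have au' : agree f S u' x.
  by apply: agree_trans au; apply/agree_sym/(line_agree Si).
have av : agree f S v x := line_agree Sj lj.
have aw' : agree f S w' x.
  apply: (square_agree e_irr hf uv ux (evW x xW) _ (evW w' w'W) au av).
  by apply: adj_other wm _ _; rewrite // eq_sym.
have aw : agree f S w x.
  apply: (square_agree e_irr hf u'v u'x (evW x xW) _ (evW w wW) au' av).
  by apply: adj_other wm' _ _.
apply: (agree_le (S := S) (x := x)) => y.
have [yW|yW] := boolP (y \in W).
  have [yc|->//|->//] := miss_both uW u'W wm wm' yW.
  by apply: agree_trans au; apply/agree_sym/(line_agree Si)/lc.
have [->//|yv] := eqVneq y v.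
have [->//|yu] := eqVneq y u; have [->//|yu'] := eqVneq y u'.
have [nw nw'] : w \notin miss y /\ w' \notin miss y.
  by split; [apply: (typ u) | apply: (typ u')]; rewrite // eq_sym.
(* By [typ], [y] is [e]-adjacent to [w] and [w'], so it is the fourth corner of the 4-cycle
   [w v w' y]. *)
apply: agree_trans (av).
apply: (square_agree e_irr hf nww'); rewrite 1?e_sym ?evW ?adj_W //.
  exact: agree_trans aw (agree_sym av).
exact: agree_trans aw' (agree_sym av).
Qed.

End ShortLine.

Lemma line_core : 2 < #|varying f| -> 2 < #|varying g| ->
  #|varying f| <= 3 /\ #|varying g| <= 3.
Proof.
move=> f3 g3; have [C2|C3] := leqP #|~: W| 2; first exact: few_outside.
have [W4|cW] := ltnP 3 #|W|; first by move: (long_line_g_le2 C3 W4); lia.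
have {}cW : #|W| = 3 by lia.
suff : #|varying f| <= 2 \/ #|varying g| <= 2 by lia.
have [/exists_inP[v vW /eqP m0]|nf] := boolP [exists v in ~: W, miss v == set0].
  by apply: (full_outside C3 cW (v := v)); rewrite // -in_setC.
apply: no_full_outside => // x xW; have [m0|[w wm]] := set_0Vmem (miss x).
  by case/exists_inP: nf; exists x; rewrite ?inE ?m0.
by exists w.
Qed.

End Core.

(** * Upper bound *)

Lemma size_undup_double (T : eqType) (s : seq T) :
  {in s, forall x, 1 < count_mem x s} -> (size (undup s)).*2 <= size s.
Proof.
move=> h; rewrite -(perm_size (perm_count_undup s)) size_flatten /shape -map_comp.
have : {subset undup s <= s} by move=> x; rewrite mem_undup.
elim: (undup s) => //= x t IH st; rewrite size_nseq.
have := h x (st x (mem_head _ _)).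
by have := IH (fun y yt => st y (mem_behead (s := x :: t) yt)); lia.
Qed.

Section Cycle5.
Variables (V I : finType) (X : eqType) (f : V -> I -> X) (e : rel V).
Hypotheses (e_irr : irreflexive e) (hf : hamming f e).

(** The coordinate changed along [x0 x1] must change back on the way round. *)
Lemma cycle5_line i0 i1 i2 i3 i4 x0 x1 x2 x3 x4 : e x0 x1 ->
    line f i0 x0 x1 -> line f i1 x1 x2 -> line f i2 x2 x3 -> line f i3 x3 x4 ->
    line f i4 x4 x0 ->
  i0 \in [:: i1; i2; i3; i4].
Proof.
move=> x01 l0 l1 l2 l3 l4; apply: contraTT x01.
rewrite !inE !negb_or => /and4P[n1 n2 n3 n4].
suff -> : x0 = x1 by rewrite e_irr.
apply: (line_coord_eq hf l0).
by rewrite (lineP _ _ _ _ l1) // (lineP _ _ _ _ l2) // (lineP _ _ _ _ l3) // (lineP _ _ _ _ l4).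
Qed.

(** Each direction occurs at least twice among five edges, so there are at most two directions. *)
Lemma cycle5_varying x0 x1 x2 x3 x4 :
    e x0 x1 -> e x1 x2 -> e x2 x3 -> e x3 x4 -> e x4 x0 ->
    (forall x, x \in [:: x0; x1; x2; x3; x4]) ->
  #|varying f| <= 2.
Proof.
move=> e0 e1 e2 e3 e4 cov.
have [i0 l0] := edge_line hf e0; have [i1 l1] := edge_line hf e1.
have [i2 l2] := edge_line hf e2; have [i3 l3] := edge_line hf e3.
have [i4 l4] := edge_line hf e4.
have c0 := cycle5_line e0 l0 l1 l2 l3 l4; have c1 := cycle5_line e1 l1 l2 l3 l4 l0.
have c2 := cycle5_line e2 l2 l3 l4 l0 l1; have c3 := cycle5_line e3 l3 l4 l0 l1 l2.
have c4 := cycle5_line e4 l4 l0 l1 l2 l3.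
pose S := [:: i0; i1; i2; i3; i4].
apply: (@leq_trans (size (undup S))).
  have L (i : I) x y : i \in S -> line f i x y -> agree f (undup S) x y.
    by move=> iS; apply: line_agree; rewrite mem_undup.
  have a1 := L _ _ _ _ l0; have a2 := L _ _ _ _ l1.
  have a3 := L _ _ _ _ l2; have a4 := L _ _ _ _ l3.
  apply: (agree_le (x := x0)) => x; apply: agree_sym.
  have {}a1 : agree f (undup S) x0 x1 by apply: a1; rewrite !inE eqxx ?orbT.
  have {}a2 : agree f (undup S) x0 x2.
    by apply: agree_trans a1 _; apply: a2; rewrite !inE eqxx ?orbT.
  have {}a3 : agree f (undup S) x0 x3.
    by apply: agree_trans a2 _; apply: a3; rewrite !inE eqxx ?orbT.
  have {}a4 : agree f (undup S) x0 x4.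
    by apply: agree_trans a3 _; apply: a4; rewrite !inE eqxx ?orbT.
  by have := cov x; rewrite !inE => /or4P[| | |/orP[]] /eqP->.
have cnt i s : i \in s -> perm_eq (i :: s) S -> 1 < count_mem i S.
  by move=> is_ /permP<- /=; rewrite eqxx add1n ltnS -has_count has_pred1.
have five n : n.*2 <= 5 -> n <= 2 by case: n => [|[|[|n]]].
apply: (five (size (undup S))).
apply: (@size_undup_double _ S) => i; rewrite !inE => /or4P[| | |/orP[]] /eqP->.
- exact: cnt c0 _.
- by apply: (cnt _ _ c1); rewrite (perm_rot 1 S).
- by apply: (cnt _ _ c2); rewrite (perm_rot 2 S).
- by apply: (cnt _ _ c3); rewrite (perm_rot 3 S).
- by apply: (cnt _ _ c4); rewrite (perm_rot 4 S).
Qed.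

Lemma triangle_line x y z : e x y -> e x z -> e y z ->
  exists i, line f i x y /\ line f i x z.
Proof.
move=> xy xz yz; have [i li] := edge_line hf yz; exists i.
have lxy := edge_two_line hf (edge_neq e_irr yz) li xy xz.
by split=> //; apply: line_trans lxy li.
Qed.

Lemma triangle_card x y z : e x y -> e x z -> e y z ->
  exists i, 2 < #|[set t | line f i x t]|.
Proof.
move=> xy xz yz; have [i [lxy lxz]] := triangle_line xy xz yz; exists i.
apply: (@leq_trans #|[set x; y; z]|).
  rewrite -setUA cardsU1 cards2 !inE negb_or.
  by rewrite (edge_neq e_irr xy) (edge_neq e_irr xz) (edge_neq e_irr yz).
apply: card_line_ge => t; rewrite !inE -!orbA => /or3P[]/eqP->//.
exact: line_refl.
Qed.

End Cycle5.

(** * Triangle-free graphs with triangle-free complement *)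

Section ShortLines.
Variables (V : finType) (e e' : rel V).
Hypotheses (e_sym : symmetric e) (e_irr : irreflexive e).
Hypothesis e'E : forall u v, u != v -> e' u v = ~~ e u v.
Hypothesis tri : forall x y z, e x y -> e x z -> e y z -> False.
Hypothesis tri' : forall x y z, e' x y -> e' x z -> e' y z -> False.

Let N v := [set x | e v x].
Let N' v := [set x | e' v x].

Lemma card_nbrs v : #|N v| <= 2.
Proof.
rewrite leqNgt; apply/negP=> /card_gt2P[x [y [z [[]]]]].
rewrite !inE => vx vy vz [xy yz zx].
have H a b : a != b -> e v a -> e v b -> e' a b.
  by move=> ab va vb; rewrite e'E //; apply/negP; apply: (tri va vb).
by apply: (tri' (H _ _ xy vx vy) (H _ _ _ vx vz) (H _ _ yz vy vz)); rewrite eq_sym.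
Qed.

Lemma card_conbrs v : #|N' v| <= 2.
Proof.
rewrite leqNgt; apply/negP=> /card_gt2P[x [y [z [[]]]]].
rewrite !inE => vx vy vz [xy yz zx].
have H a b : a != b -> e' v a -> e' v b -> e a b.
  by move=> ab va vb; apply: contraT; rewrite -e'E // => /(tri' va vb).
by apply: (tri (H _ _ xy vx vy) (H _ _ _ vx vz) (H _ _ yz vy vz)); rewrite eq_sym.
Qed.

Hypothesis V5 : 4 < #|V|.

(** Three neighbours of [v] in one graph would form a triangle in the other; so [v] has at most two
    in each, while at least four other vertices exist. *)
Lemma nbrs_eq2 v : #|N v| = 2 /\ #|N' v| = 2.
Proof.
have : #|[set: V]| <= #|v |: (N v :|: N' v)|.
  apply/subset_leq_card/subsetP => x _; rewrite !inE; have [//|xv] := eqVneq x v.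
  by rewrite e'E 1?eq_sym // orbN.
have [le1 _] := leq_card_setU [set v] (N v :|: N' v).
have [le2 _] := leq_card_setU (N v) (N' v).
move: le1 (card_nbrs v) (card_conbrs v); rewrite cardsT cards1.
by lia.
Qed.

Lemma triangle_free_cycle5 : exists x0 x1 x2 x3 x4,
  [/\ e x0 x1, e x1 x2, e x2 x3 & e x3 x4] /\ e x4 x0 /\
  forall x, x \in [:: x0; x1; x2; x3; x4].
Proof.
have /card_gt0P[v _] : 0 < #|V| by lia.
have [Nv N'v] := nbrs_eq2 v.
have /cards2P[x [y [xy Exy]]] : #|N v| == 2 by rewrite Nv.
have vx : e v x by have := set21 x y; rewrite -Exy inE.
have vy : e v y by have := set22 x y; rewrite -Exy inE.
have nxy : ~~ e x y by apply/negP; apply: tri vx vy.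
have step a : e v a -> (forall b, e a b -> e v b -> False) ->
    exists t, [/\ e a t, e' v t & t != v].
  move=> va h; have [Na _] := nbrs_eq2 a.
  have /card_gt0P[t] : 0 < #|N a :\ v|.
    by have := cardsD1 v (N a); rewrite Na inE e_sym va /=; lia.
  rewrite !inE => /andP[tv at_]; exists t; split=> //.
  by rewrite e'E 1?eq_sym //; apply/negP; apply: h at_.
have [t [xt vt tv]] := step x vx (fun b xb vb => tri vx vb xb).
have [s [ys vs sv]] := step y vy (fun b xb vb => tri vy vb xb).
(* If [t = s], the other non-neighbour [w] of [v] is [e]-adjacent to [t], which then has three
   neighbours [x], [y], [w]. *)
have ts : t != s.
  apply: contraTneq isT => ets; subst s.
  have [w wt vw] : exists2 w, w != t & e' v w.
    have /card_gt0P[w] : 0 < #|N' v :\ t|.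
      by have := cardsD1 t (N' v); rewrite N'v inE vt /=; lia.
    by rewrite !inE => /andP[]; exists w.
  have tw : e t w.
    apply: contraT; rewrite -e'E 1?eq_sym //.
    by move=> tw; case: (tri' vt vw tw).
  have := card_nbrs t; rewrite leqNgt => /negP[]; apply/card_gt2P.
  exists x, y, w; rewrite !inE ![e t _]e_sym xt ys [e w t]e_sym tw xy.
  split=> //; split=> //.
    by apply: contraTneq vw => <-; rewrite e'E ?vy // (edge_neq e_irr vy).
  by apply: contraTneq vw => ->; rewrite e'E ?vx // (edge_neq e_irr vx).
have st : e t s.
  by apply: contraT; rewrite -e'E // => /(tri' vt vs).
have EN' : N' v = [set t; s].
  apply/esym/eqP; rewrite eqEcard N'v cards2 ts leqnn andbT.
  by apply/subsetP => a; rewrite !inE => /orP[]/eqP->.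
exists v, x, t, s, y; rewrite e_sym in ys; rewrite e_sym in vy.
split; first by []; split=> // z.
have [->|zv] := eqVneq z v; first by rewrite !inE eqxx.
have : z \in N v :|: N' v by rewrite !inE e'E 1?eq_sym // orbN.
rewrite Exy EN' !inE => /orP[]/orP[]/eqP->; rewrite eqxx ?orbT //.
Qed.

End ShortLines.

Lemma agree_mono (V I : finType) (X : eqType) (f : V -> I -> X) (S S' : seq I) x y :
  {subset S <= S'} -> agree f S x y -> agree f S' x y.
Proof. by move=> sS a m mS'; apply: a; apply: contraNN mS' => /sS. Qed.

(** Grow a connected set from [x0]: each added vertex is joined by one edge and contributes at most
    one new direction. *)
Lemma varying_lt_card (V I : finType) (X : eqType) (f : V -> I -> X)
    (e : rel V) (x0 : V) :
  (forall x y, connect e x y) -> hamming f e -> #|varying f| < #|V|.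
Proof.
move=> con hf.
have H m : m < #|V| -> exists (A : {set V}) (S : seq I),
    [/\ #|A| = m.+1, size S <= m, x0 \in A & {in A, forall x, agree f S x x0}].
  elim: m => [_|m IH mV].
    exists [set x0], [::]; rewrite cards1 inE eqxx; split=> // x.
    by rewrite inE => /eqP->.
  have [A [S [cA sS xA aA]]] := IH (ltnW mV).
  have [y yA] : exists y, y \notin A.
    have /card_gt0P[y] : 0 < #|~: A| by have := cardsC A; lia.
    by rewrite inE; exists y.
  have [u [v [uA vA uv]]] := connect_exit (A := mem A) (con x0 y) xA yA.
  have [i li] := edge_line hf uv; exists (v |: A), (i :: S).
  rewrite cardsU1 vA cA inE xA orbT; split=> // x; rewrite inE in_set1.
  have aS t : t \in A -> agree f (i :: S) t x0.
    by move/aA; apply: agree_mono => j jS; rewrite inE jS orbT.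
  case/orP=> [/eqP->|]; last exact: aS.
  apply: agree_trans (aS u uA); apply/agree_sym/(line_agree _ li).
  exact: mem_head.
have V0 : 0 < #|V| by apply/card_gt0P; exists x0.
have [A [S [cA sS xA aA]]] := H #|V|.-1 ltac:(lia).
have AT : A = setT by apply/eqP; rewrite eqEcard subsetT cardsT cA prednK /=.
apply: (@leq_ltn_trans (size S)); last lia.
by apply: (agree_le (x := x0)) => x; apply: aA; rewrite AT inE.
Qed.

Lemma longest_line (V I : finType) (X : eqType) (f : V -> I -> X) :
    0 < #|V| -> 0 < #|varying f| ->
  exists i x, forall j y, #|[set z | line f j y z]| <= #|[set z | line f i x z]|.
Proof.
move=> /card_gt0P[x0 _] /card_gt0P[i0 _].
pose F (p : I * V) := #|[set z | line f p.1 p.2 z]|.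
have [[i x] _ h] := @arg_maxnP _ (i0, x0) xpredT F erefl.
by exists i, x => j y; apply: (h (j, y)).
Qed.

(** [line_core] is applied to the embedding carrying the longer line, with the two graphs exchanged
    when that is [f]. If all lines have at most two vertices, the 5-cycle contradicts
    [2 < #|varying f|]. *)
Lemma varying_le3 (V I J : finType) (X Y : eqType) (f : V -> I -> X)
    (g : V -> J -> Y) (e e' : rel V) :
    symmetric e -> irreflexive e -> symmetric e' -> irreflexive e' ->
    hamming f e -> hamming g e' ->
    (forall u v, u != v -> e' u v = ~~ e u v) ->
    (forall x y, connect e x y) -> (forall x y, connect e' x y) -> 4 < #|V| ->
    2 < #|varying f| -> 2 < #|varying g| ->
  #|varying f| <= 3 /\ #|varying g| <= 3.
Proof.
move=> es ei es' ei' hf hg e'E con con' V5 f3 g3.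
have eE u v : u != v -> e u v = ~~ e' u v by move=> /e'E->; rewrite negbK.
have [i [x mf]] := longest_line (f := f) ltac:(lia) ltac:(lia).
have [j [y mg]] := longest_line (f := g) ltac:(lia) ltac:(lia).
set F := [set z | line f i x z] in mf; set G := [set z | line g j y z] in mg.
have FE z : (z \in F) = line f i x z by rewrite inE.
have GE z : (z \in G) = line g j y z by rewrite inE.
case: (leqP #|G| 2) => [G2|G3]; last first.
  case: (leqP #|F| #|G|) => [FG|/ltnW GF].
    apply: (line_core es ei es' ei' hf hg e'E con' GE) => // k t.
    exact: leq_trans (mf k t) FG.
  apply/and_comm; apply: (line_core es' ei' es ei hg hf eE con FE) => //.
    by move=> k t; apply: leq_trans (mg k t) GF.
  exact: leq_trans GF.
case: (leqP #|F| 2) => [F2|F3]; last first.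
  apply/and_comm; apply: (line_core es' ei' es ei hg hf eE con FE) => //.
  by move=> k t; apply: leq_trans (mg k t) _; lia.
have tri a b c : e a b -> e a c -> e b c -> False.
  move=> ab ac bc; have [k] := triangle_card ei hf ab ac bc.
  by have := mf k a; lia.
have tri' a b c : e' a b -> e' a c -> e' b c -> False.
  move=> ab ac bc; have [k] := triangle_card ei' hg ab ac bc.
  by have := mg k a; lia.
have [x0 [x1 [x2 [x3 [x4 [[e0 e1 e2 e3] [e4 cov]]]]]]] :=
  triangle_free_cycle5 es ei e'E tri tri' V5.
by have := cycle5_varying ei hf e0 e1 e2 e3 e4 cov; lia.
Qed.

Lemma compl_adjE (G : sgraph) (u v : G) :
  u != v -> (@adj (compl G)) u v = ~~ adj u v.
Proof. by move=> uv; apply: (andb_idl (fun _ => uv)). Qed.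

Lemma md_lt (G : sgraph) : 0 < #|G| -> connected G -> md G < #|G|.
Proof.
move=> /card_gt0P[x _] con; have [I [f [hf <-]]] := md_hamming con.
exact: varying_lt_card x con hf.
Qed.

Lemma md_gt0 (G : sgraph) : 1 < #|G| -> connected G -> 0 < md G.
Proof.
move=> /card_gt1P[x [y [_ _ nxy]]] con.
have hf : hamming (fun (x : G) (_ : unit) => x) (@adj G).
  split=> [u v /(_ tt)//|u v _]; exists tt.
  by apply/lineP => -[]; rewrite eqxx.
apply: leq_trans (hamming_md con hf); apply/card_gt0P; exists tt.
by rewrite inE; apply/existsP; exists x; apply/existsP; exists y.
Qed.

(** Either both numbers are at most 3, or one is at most 2 and the other at most [#|G| - 1]. The
    maximum is 9 for orders 4 and 5, and [2 * (#|G| - 1)] from order 6 on. *)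
Lemma md_product_le (G : sgraph) : 3 < #|G| -> connected G -> connected (compl G) ->
  md G * md (compl G) <= maxn 9 (2 * (#|G| - 1)).
Proof.
move=> G4 con con'.
have G0 : 0 < #|G| by lia.
have kn : md G < #|G| := md_lt G0 con.
have ln : md (compl G) < #|G| := @md_lt (compl G) G0 con'.
have le9 : md G <= 3 -> md (compl G) <= 3 ->
    md G * md (compl G) <= maxn 9 (2 * (#|G| - 1)).
  by move=> k3 l3; apply: leq_trans (leq_mul k3 l3) (leq_maxl _ _).
have [G5|G5] := leqP #|G| 4.
  by apply: le9; rewrite -ltnS; [apply: leq_trans kn _ | apply: leq_trans ln _].
have [k2|k3] := leqP (md G) 2.
  by apply: leq_trans (leq_mul k2 (_ : _ <= #|G| - 1)) (leq_maxr _ _); lia.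
have [l2|l3] := leqP (md (compl G)) 2.
  rewrite mulnC; apply: leq_trans (leq_mul l2 (_ : _ <= #|G| - 1)) (leq_maxr _ _).
  by lia.
have [I [f [hf ef]]] := md_hamming con; have [J [g [hg eg]]] := md_hamming con'.
have [] := varying_le3 (@adj_sym G) (@adj_irrefl G) (@adj_sym (compl G))
  (@adj_irrefl (compl G)) hf hg (@compl_adjE G) con con' G5 _ _; rewrite ?ef ?eg //.
Qed.

(** * Lower bounds for orders 4, 5 and 6 *)

Definition diffs d (p q : seq nat) := [seq k <- iota 0 d | nth 0 p k != nth 0 q k].

(** A computable form of an embedding with [d] varying coordinates: row [i] of [L] holds the
    coordinates of vertex [i]. *)
Definition labelling d (L : seq (seq nat)) :=
  [&& all (fun r => size r == d) L, uniq L
    & all (fun k => 1 < size (undup [seq nth 0 r k | r <- L])) (iota 0 d)].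

Definition on_line d (L : seq (seq nat)) i j :=
  size (diffs d (nth [::] L i) (nth [::] L j)) == 1.

Lemma diffs_sym d p q : diffs d p q = diffs d q p.
Proof. by apply: eq_filter => k; rewrite eq_sym. Qed.

Lemma labelling_md (G : sgraph) (s : seq G) (d : nat) L :
    uniq s -> (forall x, x \in s) -> size L = size s -> labelling d L -> connected G ->
    (forall x y, adj x y -> on_line d L (index x s) (index y s)) ->
  d <= md G.
Proof.
move=> us cs sL /and3P[/allP Ld uL /allP Lc] con adjL.
pose row x := nth [::] L (index x s).
pose f x (k : 'I_d) := nth 0 (row x) k.
have ix x : index x s < size L by rewrite sL index_mem.
have sr x : size (row x) = d by apply/eqP/Ld/mem_nth.
have hf : hamming f (@adj G).
  split=> x y.
    move=> fxy; have : row x = row y.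
      apply: (@eq_from_nth _ 0); rewrite !sr // => k kd.
      exact: (fxy (Ordinal kd)).
    move/eqP; rewrite nth_uniq // => /eqP exy.
    by have := congr1 (nth x s) exy; rewrite !nth_index.
  move=> /adjL; rewrite /on_line -/(row x) -/(row y); set D := diffs _ _ _.
  case E: D => [//|k [|//]] _.
  have kd : k < d by have := mem_head k [::]; rewrite -E mem_filter mem_iota => /and3P[].
  exists (Ordinal kd); apply/lineP => j; apply: contraNeq => neq.
  have : (j : nat) \in D.
    by rewrite mem_filter mem_iota add0n; apply/and3P; split=> //; apply: ltn_ord.
  by rewrite E inE => /eqP ejk; apply/eqP/val_inj.
rewrite -[d]card_ord -cardsT; apply: leq_trans (hamming_md con hf).
apply/subset_leq_card/subsetP => k _; apply/negPn/negP => /varyingPn fk.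
have := Lc k ltac:(by rewrite mem_iota ltn_ord); apply/negP; rewrite -leqNgt.
have H r r' : r \in L -> r' \in L -> nth 0 r k = nth 0 r' k.
  have R t : t \in L -> exists x, t = row x.
    move=> tL; have iL : index t L < size s by rewrite -sL index_mem.
    case E: s us cs sL iL => [|x0 s'] //; rewrite -E => us cs sL iL.
    exists (nth x0 s (index t L)); rewrite /row index_uniq // nth_index //.
  by move=> /R[x ->] /R[y ->]; apply: fk.
case: L H {Ld uL Lc adjL row f ix sr hf fk sL} => // r L H.
apply: (uniq_leq_size (s2 := [:: nth 0 r k]) (undup_uniq _)) => t.
rewrite mem_undup => /mapP[r' r'L ->]; rewrite inE; apply/eqP.
by apply: H; rewrite ?mem_head.
Qed.

(** * The exhaustive search and its soundness *)

Definition index_pairs n := [seq (i, j) | i <- iota 0 n, j <- iota i.+1 (n - i.+1)].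

(* A template [(d, mask)] stores the pairs that a graph may join; tag [0]
   marks disconnected graphs, a tag [d > 0] graphs with [d <= md]. *)
Definition template := (nat * seq bool)%type.

Fixpoint fits (bits mask : seq bool) :=
  if bits is b :: bits' then (b ==> head false mask) && fits bits' (behead mask)
  else true.

Definition step (b : bool) (A : seq template) : seq template :=
  [seq (a.1, behead a.2) | a <- A & b ==> head false a.2].

Definition tags (bits : seq bool) (A : seq template) :=
  [seq a.1 | a <- A & fits bits a.2].

(** A tag [0] settles the pair because one of the two graphs is disconnected. The default 1 in the
    folds is the bound [md_gt0]. *)
Definition enough b (s t : seq nat) :=
  [|| 0 \in s, 0 \in t | b <= foldr maxn 1 s * foldr maxn 1 t].

(** Each remaining pair is an edge of exactly one of the graph and its complement; templates that
    forbid this edge are dropped at once. *)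
Fixpoint cover b (A B : seq template) k :=
  if k is k'.+1 then cover b (step true A) (step false B) k' &&
    cover b (step false A) (step true B) k'
  else enough b [seq a.1 | a <- A] [seq a.1 | a <- B].

Definition steps (bits : seq bool) (A : seq template) :=
  foldl (fun A b => step b A) A bits.

Lemma tags_cons b bits A : tags (b :: bits) A = tags bits (step b A).
Proof.
rewrite /tags /step filter_map -map_comp -filter_predI.
by congr map; apply: eq_filter => a /=; rewrite andbC.
Qed.

Lemma tags_nil A : tags [::] A = [seq a.1 | a <- A].
Proof. by rewrite /tags filter_predT. Qed.

Lemma tags_cat bits bits' A : tags (bits ++ bits') A = tags bits' (steps bits A).
Proof. by elim: bits A => //= b bits IH A; rewrite tags_cons IH. Qed.

Lemma coverP b A B bits :
  cover b A B (size bits) -> enough b (tags bits A) (tags [seq ~~ x | x <- bits] B).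
Proof.
elim: bits A B => [|x bits IH] A B; first by rewrite /= !tags_nil.
by move=> /andP[h1 h2]; rewrite [map _ _]/= !tags_cons; case: x; apply: IH.
Qed.

(* The first [n] pairs are [(0, j)]. Listing the neighbours of vertex [0] before
   its non-neighbours, only the patterns [1^d 0^(n-d)] need be searched. *)
Definition search b n (A : seq template) :=
  all (fun d => let p := nseq d true ++ nseq (n - d) false in
    cover b (steps p A) (steps [seq ~~ x | x <- p] A) (size (index_pairs n.+1) - n)) (iota 0 n.+1).

Lemma searchP b n A d bits :
    search b n A -> d <= n -> size bits = size (index_pairs n.+1) - n ->
  let full := (nseq d true ++ nseq (n - d) false) ++ bits in
  enough b (tags full A) (tags [seq ~~ x | x <- full] A).
Proof.
move=> /allP h dn sb /=; rewrite map_cat !tags_cat; apply: coverP.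
by rewrite sb; apply: h; rewrite mem_iota.
Qed.

Definition mask (r : rel nat) n := [seq r p.1 p.2 | p <- index_pairs n].

Definition colourings n := iter n (fun s => [seq b :: t | t <- s, b <- [:: true; false]]) [:: [::]].

(** A graph is disconnected when no edge crosses some bipartition [c] with two nonempty classes; the
    mask allows exactly the pairs within a class. *)
Definition cuts n : seq template :=
  [seq (0, mask (fun i j => nth true c i == nth true c j) n)
     | c <- colourings n & ~~ constant c].

Definition relabellings n d L : seq template :=
  [seq (d, mask (on_line d [seq nth [::] L i | i <- q]) n) | q <- permutations (iota 0 n)].

Definition templates n (Ls : seq (nat * seq (seq nat))) :=
  cuts n ++ flatten [seq relabellings n L.1 L.2 | L <- Ls].

(* Found by computer enumeration: coordinates of maximal graphs with [md >= 2] or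
   [md >= 3] which, up to relabelling, contain enough graphs for [search]. *)
Definition labellings4 := [:: (3, [:: [:: 0; 0; 0]; [:: 1; 0; 0]; [:: 0; 1; 0]; [:: 0; 1; 1]])].

Definition labellings5 := [::
  (2, [:: [:: 0; 0]; [:: 1; 0]; [:: 2; 0]; [:: 3; 0]; [:: 0; 1]]);
  (2, [:: [:: 0; 0]; [:: 1; 0]; [:: 2; 0]; [:: 0; 1]; [:: 0; 2]]);
  (2, [:: [:: 0; 0]; [:: 1; 0]; [:: 2; 0]; [:: 0; 1]; [:: 1; 1]])].

Definition labellings6 := [::
  (2, [:: [:: 0; 0]; [:: 1; 0]; [:: 2; 0]; [:: 3; 0]; [:: 4; 0]; [:: 0; 1]]);
  (2, [:: [:: 0; 0]; [:: 1; 0]; [:: 2; 0]; [:: 3; 0]; [:: 0; 1]; [:: 0; 2]]);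
  (2, [:: [:: 0; 0]; [:: 1; 0]; [:: 2; 0]; [:: 3; 0]; [:: 0; 1]; [:: 1; 1]]);
  (2, [:: [:: 0; 0]; [:: 1; 0]; [:: 2; 0]; [:: 0; 1]; [:: 1; 1]; [:: 2; 1]]);
  (3, [:: [:: 0; 0; 0]; [:: 1; 0; 0]; [:: 2; 0; 0]; [:: 0; 1; 0]; [:: 1; 1; 0]; [:: 0; 0; 1]]);
  (3, [:: [:: 0; 0; 0]; [:: 1; 0; 0]; [:: 2; 0; 0]; [:: 0; 1; 0]; [:: 1; 1; 0]; [:: 2; 0; 1]]);
  (3, [:: [:: 0; 0; 0]; [:: 1; 0; 0]; [:: 2; 0; 0]; [:: 3; 0; 0]; [:: 0; 1; 0]; [:: 0; 1; 1]]);
  (3, [:: [:: 0; 0; 0]; [:: 1; 0; 0]; [:: 2; 0; 0]; [:: 0; 1; 0]; [:: 0; 1; 1]; [:: 0; 1; 2]])].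

Lemma mem_index_pairs n i j : ((i, j) \in index_pairs n) = (i < j < n).
Proof.
apply/allpairsPdep/andP => [[i' [j' [ii jj [-> ->]]]]|[ij jn]].
  by move: ii jj; rewrite !mem_iota; lia.
by exists i, j; rewrite !mem_iota; split=> //; lia.
Qed.

Lemma fits_mask n (r r' : rel nat) i j :
  fits (mask r n) (mask r' n) -> i < j < n -> r i j -> r' i j.
Proof.
rewrite -mem_index_pairs /mask => h ijP.
have : all (fun p => r p.1 p.2 ==> r' p.1 p.2) (index_pairs n).
  by elim: (index_pairs n) h => //= p s IH /andP[-> /IH].
by move=> /allP/(_ _ ijP)/implyP.
Qed.

Lemma size_colourings n c : c \in colourings n -> size c = n.
Proof.
rewrite /colourings; elim: n c => [|m IH] c; first by rewrite inE => /eqP->.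
by case/allpairsP=> -[t b] [/= /IH st _ ->] /=; rewrite st.
Qed.

Section Templates.
Variables (n : nat) (G : sgraph) (x0 : G) (s : seq G).
Hypotheses (us : uniq s) (cs : forall x, x \in s) (sn : size s = n).
Hypothesis con : connected G.

Definition adj_mask := mask (fun i j => adj (nth x0 s i) (nth x0 s j)) n.

Lemma fits_adj (r : rel nat) x y : symmetric r -> fits adj_mask (mask r n) ->
  adj x y -> r (index x s) (index y s).
Proof.
move=> rs h xy; have [ix iy] : index x s < n /\ index y s < n.
  by rewrite -sn !index_mem.
have H := fits_mask h.
case: (ltngtP (index x s) (index y s)) => [lt|gt|e].
- by apply: H; rewrite ?lt // !nth_index.
- by rewrite rs; apply: H; rewrite ?gt // !nth_index // adj_sym.
have exy : x = y by have := congr1 (nth x s) e; rewrite !nth_index.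
by rewrite exy adj_irrefl in xy.
Qed.

Lemma cuts_sound a : a \in cuts n -> ~~ fits adj_mask a.2.
Proof.
case/mapP=> c; rewrite mem_filter => /andP[nc cc] ->; apply: contra nc => /= h.
have sc := size_colourings cc.
have H x y : adj x y -> nth true c (index x s) == nth true c (index y s).
  by apply: fits_adj h => i j; rewrite eq_sym.
have Hc x y : nth true c (index x s) = nth true c (index y s).
  apply/eqP; apply: contraT => ne; rewrite eq_sym in ne.
  have [u [v [/eqP hu hv /H]]] :=
    connect_exit (A := fun z => nth true c (index z s) == nth true c (index x s))
      (con x y) (eqxx _) ne.
  by rewrite hu eq_sym (negPf hv).
apply/(constantP true); exists (nth true c (index x0 s)).
apply: (@eq_from_nth _ true); rewrite ?size_nseq // => i; rewrite sc => i_n.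
by rewrite nth_nseq i_n (Hc x0 (nth x0 s i)) index_uniq // sn.
Qed.

Lemma relabellings_sound d L a : 0 < d -> size L = n -> labelling d L ->
  a \in relabellings n d L -> fits adj_mask a.2 -> 0 < a.1 <= md G.
Proof.
move=> d0 sL /and3P[Ld uL Lc] /mapP[q]; rewrite mem_permutations => pq -> /= h.
set L' := [seq _ | i <- q] in h.
have pL : perm_eq L' L.
  apply: perm_trans (perm_map _ pq) _.
  by rewrite -sL -/(mkseq _ _) mkseq_nth.
rewrite d0; apply: (labelling_md (L := L') us cs _ _ con).
- by rewrite (perm_size pL) sL.
- apply/and3P; split.
  + by rewrite (perm_all _ pL).
  + by rewrite (perm_uniq pL).
  apply/allP => k /(allP Lc) lt; apply: leq_trans lt _.
  by rewrite (perm_size (perm_undup (perm_mem (perm_map (fun r => nth 0 r k) pL)))).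
move=> x y; apply: fits_adj h => i j.
by rewrite /on_line diffs_sym.
Qed.

Lemma templates_sound Ls a :
    all (fun L => [&& 0 < L.1, size L.2 == n & labelling L.1 L.2]) Ls ->
    a \in templates n Ls -> fits adj_mask a.2 -> 0 < a.1 <= md G.
Proof.
move=> /allP ok; rewrite mem_cat => /orP[/cuts_sound/negP//|].
case/flatten_mapP=> L LL; have /and3P[d0 /eqP sL lL] := ok L LL.
exact: relabellings_sound.
Qed.

Lemma tags_sound Ls (A := tags adj_mask (templates n Ls)) :
    all (fun L => [&& 0 < L.1, size L.2 == n & labelling L.1 L.2]) Ls ->
    0 < md G -> 0 \notin A /\ foldr maxn 1 A <= md G.
Proof.
move=> ok mG; have H t : t \in A -> 0 < t <= md G.
  by case/mapP=> a; rewrite mem_filter => /andP[fa aT] ->; apply: templates_sound aT fa.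
split; first by apply/negP => /H.
elim: A H => //= t A IH H; rewrite geq_max IH ?andbT; last first.
  by move=> u uA; apply: H; rewrite inE uA orbT.
by have /andP[] := H t (mem_head _ _).
Qed.

End Templates.

Lemma search_sound b n Ls (G : sgraph) : 
    search b n (templates n.+1 Ls) ->
    all (fun L => [&& 0 < L.1, size L.2 == n.+1 & labelling L.1 L.2]) Ls ->
    #|G| = n.+1 -> 0 < n -> connected G -> connected (compl G) ->
  b <= md G * md (compl G).
Proof.
move=> hs ok Gn n0 con con'; have /card_gt0P[v _] : 0 < #|G| by rewrite Gn.
have g1 : 1 < #|G| by rewrite Gn ltnS.
(* Listing [v], its neighbours, then its non-neighbours gives the adjacency row of [v] the pattern
   covered by [search]. *)
pose N := [seq x <- enum G | (x != v) && adj v x].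
pose M := [seq x <- enum G | (x != v) && ~~ adj v x].
pose s := v :: N ++ M.
have us : uniq s.
  rewrite /= mem_cat [v \in N]mem_filter [v \in M]mem_filter eqxx /= cat_uniq.
  apply/and3P; split; try exact: filter_uniq (enum_uniq _).
  apply/hasPn => x; rewrite mem_filter => /andP[/andP[_ /negPf nvx] _].
  by rewrite mem_filter nvx andbF.
have cs x : x \in s.
  rewrite inE mem_cat [x \in N]mem_filter [x \in M]mem_filter mem_enum.
  by case: eqP => //=; case: (adj v x).
have ss : size s = n.+1.
  rewrite -Gn cardE; apply/perm_size; apply: uniq_perm us (enum_uniq _) _ => x.
  by rewrite cs mem_enum.
have sNM : size N + size M = n by move: ss => /= [<-]; rewrite size_cat.
have dn : size N <= n by rewrite -sNM leq_addr.
set P := [seq (i, j) | i <- iota 1 n, j <- iota i.+1 (n.+1 - i.+1)].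
have EP : index_pairs n.+1 = [seq (0, j) | j <- iota 1 n] ++ P.
  by rewrite /index_pairs /= subn1.
pose r i j := adj (nth v s i) (nth v s j).
pose bits := [seq r p.1 p.2 | p <- P].
have Em : adj_mask n.+1 v s = (nseq (size N) true ++ nseq (n - size N) false) ++ bits.
  rewrite /adj_mask /mask EP map_cat; congr cat.
  rewrite -map_comp (eq_map (g := fun j => adj v (nth v s j))) //.
  have -> : [seq adj v (nth v s j) | j <- iota 1 n] = [seq adj v x | x <- N ++ M].
    rewrite (iotaDl 1 0) -map_comp -[N ++ M in RHS](mkseq_nth v) /mkseq -map_comp size_cat sNM.
    exact: eq_map.
  rewrite map_cat -sNM addKn; congr cat.
    rewrite -(size_map (adj v) N); apply/all_pred1P/allP => _ /mapP[x xN ->].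
    by move: xN; rewrite mem_filter => /andP[/andP[_ ->]].
  rewrite -(size_map (adj v) M); apply/all_pred1P/allP => _ /mapP[x xM ->].
  by move: xM; rewrite mem_filter => /andP[/andP[_ /negPf->]].
have sb : size bits = size (index_pairs n.+1) - n.
  by rewrite EP size_cat !size_map size_iota addKn.
have Em' : adj_mask (G := compl G) n.+1 v s = [seq ~~ x | x <- adj_mask n.+1 v s].
  rewrite /adj_mask /mask -map_comp; apply/eq_in_map => -[i j].
  rewrite mem_index_pairs => /andP[ij jn] /=; apply: compl_adjE.
  by rewrite nth_uniq ?ss ?(ltn_eqF ij) // (ltn_trans ij).
have := searchP hs dn sb; cbv zeta; rewrite -Em -Em'.
have [z m] := tags_sound v us cs ss con ok (md_gt0 g1 con).
have [z' m'] := tags_sound (G := compl G) v us cs ss con' ok (@md_gt0 (compl G) g1 con').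
rewrite /enough (negPf z) (negPf z') /= => le.
exact: leq_trans le (leq_mul m m').
Qed.

Lemma md_product_ge4 (G : sgraph) : #|G| = 4 -> connected G -> connected (compl G) ->
  9 <= md G * md (compl G).
Proof. by move=> G4; apply: (@search_sound 9 3 labellings4) => //; vm_compute. Qed.

Lemma md_product_ge5 (G : sgraph) : #|G| = 5 -> connected G -> connected (compl G) ->
  4 <= md G * md (compl G).
Proof. by move=> G4; apply: (@search_sound 4 4 labellings5) => //; vm_compute. Qed.

Lemma md_product_ge6 (G : sgraph) : #|G| = 6 -> connected G -> connected (compl G) ->
  3 <= md G * md (compl G).
Proof. by move=> G4; apply: (@search_sound 3 5 labellings6) => //; vm_compute. Qed.

(** * Extremal graphs *)

Section NatGraph.
Variables (n : nat) (r : rel nat).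

Definition nat_rel : rel nat := fun i j => (i != j) && (r i j || r j i).
Definition nat_corel : rel nat := fun i j => (i != j) && ~~ nat_rel i j.
Definition nat_adj : rel 'I_n := fun x y => nat_rel x y.

Lemma nat_adj_sym : symmetric nat_adj.
Proof. by move=> x y; rewrite /nat_adj /nat_rel eq_sym orbC. Qed.

Lemma nat_adj_irrefl : irreflexive nat_adj.
Proof. by move=> x; rewrite /nat_adj /nat_rel eqxx. Qed.

Definition nat_graph := SGraph nat_adj_sym nat_adj_irrefl.

Lemma card_nat_graph : #|nat_graph| = n.
Proof. exact: card_ord. Qed.

Lemma conat_adjE (x y : compl nat_graph) : adj x y = nat_corel x y.
Proof. by []. Qed.

End NatGraph.

(** A rooted spanning tree as certificate: [mu] decreases along [par], so following parents ends at
    the root. *)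
Lemma connect_root n (e : rel 'I_n) (q : rel nat) (root : nat) (mu par : nat -> nat) :
    symmetric e -> (forall x y, e x y = q x y) ->
    (forall i, i < n -> i != root -> [&& par i < n, mu (par i) < mu i & q i (par i)]) ->
  forall x y, connect e x y.
Proof.
move=> es eE h; suff H (x : 'I_n) : exists2 y : 'I_n, (y : nat) = root & connect e x y.
  move=> x y; have [a ar xa] := H x; have [b br yb] := H y.
  have ab : a = b by apply/val_inj; rewrite /= ar br.
  by apply: connect_trans xa _; rewrite sym_connect_sym // ab.
have [k] := ubnP (mu x); elim: k x => // k IH x; rewrite ltnS => lek.
have [xr|xr] := eqVneq (x : nat) root; first by exists x.
have /and3P[pn lt qp] := h x (ltn_ord x) xr.
have [|y yr cy] := IH (Ordinal pn); first exact: leq_trans lt lek.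
by exists y => //; apply: connect_trans cy; apply: connect1; rewrite eE.
Qed.

Definition all_below n (p : rel nat) := all (fun i => all (p i) (iota 0 n)) (iota 0 n).

Lemma all_belowP n p (x y : 'I_n) : all_below n p -> p x y.
Proof.
move=> /allP/(_ x); rewrite mem_iota ltn_ord => /(_ isT)/allP/(_ y).
by rewrite mem_iota ltn_ord => ->.
Qed.

Lemma ord_labelling_md n (e : rel 'I_n) (es : symmetric e) (ei : irreflexive e)
    (q : rel nat) d L (G := SGraph es ei : sgraph) :
    (forall x y, e x y = q x y) -> connected G -> size L = n -> labelling d L ->
    all_below n (fun i j => q i j ==> on_line d L i j) ->
  d <= md G.
Proof.
move=> eE con sL lL h.
apply: (@labelling_md G (enum 'I_n) d L _ _ _ lL con).
- exact: enum_uniq.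
- by move=> x; rewrite mem_enum.
- by rewrite size_enum_ord.
move=> x y /=; rewrite eE !index_enum_ord => qxy.
by apply: (implyP (all_belowP x y h)).
Qed.

Lemma nat_graph_connected n r root mu par :
    (forall i, i < n -> i != root ->
      [&& par i < n, mu (par i) < mu i & nat_rel r i (par i)]) ->
  connected (nat_graph n r).
Proof. exact: connect_root (@nat_adj_sym n r) (fun _ _ => erefl). Qed.

Lemma conat_graph_connected n r root mu par :
    (forall i, i < n -> i != root ->
      [&& par i < n, mu (par i) < mu i & nat_corel r i (par i)]) ->
  connected (compl (nat_graph n r)).
Proof. exact: connect_root (@adj_sym (compl (nat_graph n r))) (@conat_adjE n r). Qed.

Lemma all_below_root n (q : rel nat) root (mu par : nat -> nat) :
    all (fun i => (i == root) || [&& par i < n, mu (par i) < mu i & q i (par i)]) (iota 0 n) ->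
  forall i, i < n -> i != root -> [&& par i < n, mu (par i) < mu i & q i (par i)].
Proof.
by move=> /allP h i i_n ir; have := h i; rewrite mem_iota i_n (negPf ir); apply.
Qed.

Definition c5_edges : rel nat :=
  fun i j => (i, j) \in [:: (0, 1); (1, 2); (2, 3); (3, 4); (0, 4)].
Definition c5 := nat_graph 5 c5_edges.

(** The complement of the 5-cycle is the 5-cycle [0 2 4 1 3], so [cycle5_varying] bounds both
    factors by 2. *)
Lemma md_product_attained5_4 : md_product_attained 5 4.
Proof.
have con : connected c5.
  exact: (nat_graph_connected (root := 0) (mu := id)
    (par := predn) (all_below_root _)).
have con' : connected (compl c5).
  exact: (conat_graph_connected (root := 0) (mu := nth 0 [:: 0; 3; 1; 4; 2])
    (par := nth 0 [:: 0; 4; 0; 1; 2]) (all_below_root _)).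
pose o k (h : k < 5) : c5 := Ordinal h.
have k2 : md c5 <= 2.
  have [I [f [hf <-]]] := md_hamming con.
  apply: (cycle5_varying (@adj_irrefl c5) hf (x0 := @o 0 isT) (x1 := @o 1 isT)
    (x2 := @o 2 isT) (x3 := @o 3 isT) (x4 := @o 4 isT)) => //.
  by case=> [[|[|[|[|[|i]]]]] hi].
have l2 : md (compl c5) <= 2.
  have [I [f [hf <-]]] := md_hamming con'.
  apply: (cycle5_varying (@adj_irrefl (compl c5)) hf (x0 := @o 0 isT) (x1 := @o 2 isT)
    (x2 := @o 4 isT) (x3 := @o 1 isT) (x4 := @o 3 isT)) => //.
  by case=> [[|[|[|[|[|i]]]]] hi].
have c5n : #|c5| = 5 := card_nat_graph 5 c5_edges.
exists c5; split=> //; apply/eqP; rewrite eqn_leq md_product_ge5 // andbT.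
exact: leq_mul k2 l2.
Qed.

Definition bull_edges : rel nat :=
  fun i j => (i, j) \in [:: (0, 1); (0, 2); (1, 2); (1, 3); (2, 4)].
Definition bull := nat_graph 5 bull_edges.

(** The bull is self-complementary; its triangle and its two pendant edges get three different
    colours. *)
Lemma md_product_attained5_9 : md_product_attained 5 9.
Proof.
have con : connected bull.
  exact: (nat_graph_connected (root := 0) (mu := id)
    (par := nth 0 [:: 0; 0; 0; 1; 2]) (all_below_root _)).
have con' : connected (compl bull).
  exact: (conat_graph_connected (root := 0) (mu := nth 0 [:: 0; 2; 2; 1; 1])
    (par := nth 0 [:: 0; 4; 3; 0; 0]) (all_below_root _)).
have k3 : 3 <= md bull.
  by apply: (ord_labelling_md (q := nat_rel bull_edges) (L := [:: [:: 0; 0; 0];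
    [:: 1; 0; 0]; [:: 2; 0; 0]; [:: 1; 1; 0]; [:: 2; 0; 1]]) _ con).
have l3 : 3 <= md (compl bull).
  by apply: (ord_labelling_md (q := nat_corel bull_edges) (L := [:: [:: 0; 0; 0];
    [:: 2; 1; 0]; [:: 1; 0; 1]; [:: 1; 0; 0]; [:: 2; 0; 0]]) _ con').
have n5 : #|bull| = 5 := card_nat_graph 5 bull_edges.
exists bull; split=> //; apply/eqP; rewrite eqn_leq (leq_mul k3 l3) andbT.
by apply: leq_trans (md_product_le _ con con') _; rewrite n5.
Qed.

Definition barbell_edges : rel nat :=
  fun i j => (i, j) \in [:: (0, 1); (0, 2); (1, 2); (0, 3); (3, 4); (3, 5); (4, 5)].
Definition barbell := nat_graph 6 barbell_edges.

(** Two triangles joined by a bridge allow at most three directions. The complement is [K_{3,3}]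
    minus the edge [0 3]: its [K_{2,3}] puts [1] and [2] on a line that absorbs [3], [4], [5] and
    then [0]. *)
Lemma md_product_attained6_3 : md_product_attained 6 3.
Proof.
have con : connected barbell.
  exact: (nat_graph_connected (root := 0) (mu := id)
    (par := nth 0 [:: 0; 0; 0; 0; 3; 3]) (all_below_root _)).
have con' : connected (compl barbell).
  exact: (conat_graph_connected (root := 4) (mu := nth 0 [:: 1; 1; 1; 2; 0; 2])
    (par := nth 0 [:: 4; 4; 4; 1; 4; 1]) (all_below_root _)).
pose o k (h : k < 6) : barbell := Ordinal h.
have k3 : md barbell <= 3.
  have [I [f [hf <-]]] := md_hamming con; have ei := @adj_irrefl barbell.
  have [i [a1 a2]] : exists i, line f i (@o 0 isT) (@o 1 isT) /\ line f i (@o 0 isT) (@o 2 isT).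
    by apply: (triangle_line ei hf).
  have [j b] : exists j, line f j (@o 0 isT) (@o 3 isT) by apply: (edge_line hf).
  have [k [c1 c2]] : exists k, line f k (@o 3 isT) (@o 4 isT) /\ line f k (@o 3 isT) (@o 5 isT).
    by apply: (triangle_line ei hf).
  pose S := [:: i; j; k].
  have a3 : agree f S (@o 0 isT) (@o 3 isT) by apply: line_agree b; rewrite !inE eqxx orbT.
  apply: (agree_le (S := S) (x := @o 0 isT)) => x; apply: agree_sym.
  have A t u v : t \in S -> line f t u v -> agree f S u v by apply: line_agree.
  have [iS kS] : i \in S /\ k \in S by rewrite !inE !eqxx !orbT.
  case: x => [[|[|[|[|[|[|x]]]]]] hx] //.
  - by rewrite (bool_irrelevance hx isT).
  - by rewrite (bool_irrelevance hx isT); apply: A a1.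
  - by rewrite (bool_irrelevance hx isT); apply: A a2.
  - by rewrite (bool_irrelevance hx isT).
  - by rewrite (bool_irrelevance hx isT); apply: agree_trans a3 (A _ _ _ kS c1).
  - by rewrite (bool_irrelevance hx isT); apply: agree_trans a3 (A _ _ _ kS c2).
have l1 : md (compl barbell) <= 1.
  have [I [f [hf <-]]] := md_hamming con'; have ei := @adj_irrefl (compl barbell).
  pose p k (h : k < 6) : compl barbell := Ordinal h.
  have [i li] : exists i, line f i (@p 1 isT) (@p 2 isT).
    by apply: (k23_line ei hf (a := @p 3 isT) (b := @p 4 isT) (c := @p 5 isT)) => // x;
      rewrite !inE => /or3P[]/eqP->.
  have l k (h : k < 6) : 2 < k -> line f i (@p 1 isT) (@p k h).
    move=> k2; rewrite line_sym; apply: (edge_two_line hf _ li) => //.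
      by case: k h k2 => [|[|[|[|[|[|k]]]]]].
    by case: k h k2 => [|[|[|[|[|[|k]]]]]].
  have l0 : line f i (@p 1 isT) (@p 0 isT).
    apply: (line_trans (l 4 isT isT)); rewrite line_sym.
    apply: (edge_two_line hf (y := @p 5 isT)) => //.
    by apply: line_trans (l 5 isT isT); rewrite line_sym; apply: l.
  apply: (agree_le (S := [:: i]) (x := @p 1 isT)) => x; apply: agree_sym.
  apply: (line_agree (i := i)); rewrite ?inE //.
  case: x => [[|[|[|x]]] hx]; last exact: l.
  - by rewrite (bool_irrelevance hx isT).
  - by rewrite (bool_irrelevance hx isT); apply: line_refl.
  - by rewrite (bool_irrelevance hx isT).
have n6 : #|barbell| = 6 := card_nat_graph 6 barbell_edges.
exists barbell; split=> //; apply/eqP; rewrite eqn_leq md_product_ge6 // andbT.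
exact: leq_mul k3 l1.
Qed.

(** * Upper bounds attained by a star with one subdivided edge *)

Section Spider.
Variable m : nat.
Let n := m.+4.

Definition spider_edges : rel nat :=
  fun i j => ((i == 0) && (0 < j < n.-1)) || ((i == 1) && (j == n.-1)).
Definition spider := nat_graph n spider_edges.

Lemma spider_connected : connected spider.
Proof.
apply: (nat_graph_connected (root := 0) (mu := id)
  (par := fun i => if i == n.-1 then 1 else 0)) => i i_n i0.
by move: i_n i0; rewrite /nat_rel /spider_edges /n /=; case: ifP => /eqP; lia.
Qed.

Lemma spider_compl_connected : connected (compl spider).
Proof.
apply: (conat_graph_connected (root := n.-1) (mu := fun i => n - i)
  (par := fun i => if i == 1 then 2 else n.-1)) => i i_n i0.
by move: i_n i0; rewrite /nat_corel /nat_rel /spider_edges /n /=; case: ifP => /eqP; lia.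
Qed.

Lemma spider_md : n.-1 <= md spider.
Proof.
(* The graph is a tree rooted at [0], and each edge gets its own colour: coordinate [i > 0] marks
   the vertices cut off by the edge from [i] to its parent. *)
pose f (x i : 'I_n) := [&& 0 < i & (x == i) || (i == 1 :> nat) && (x == n.-1 :> nat)].
have hf : hamming f (@adj spider).
  split=> [u v fuv|u v].
    apply/val_inj => /=; move: (fuv u) (fuv v); rewrite /f !eqxx -!val_eqE /=.
    by lia.
  case: u => u u_n; case: v => v v_n; rewrite /adj /= /nat_adj /nat_rel /spider_edges /= => uv.
  exists (if u < v then Ordinal v_n else Ordinal u_n); apply/lineP => -[i i_n].
  by case: (ltnP u v) => lt; rewrite /f -!val_eqE /=; lia.
apply: leq_trans (hamming_md spider_connected hf).
have -> : n.-1 = #|[set~ (ord0 : 'I_n)]| by rewrite cardsC1 card_ord.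
apply/subset_leq_card/subsetP => i; rewrite !inE => i0.
apply/existsP; exists i; apply/existsP; exists ord0.
by move: i0; rewrite /f -!val_eqE /=; lia.
Qed.

Lemma spider_compl_md : 2 <= md (compl spider).
Proof.
(* In the complement [0] is pendant at [n.-1]. Coordinate [true] singles out [0]; coordinate [false]
   merges it with [n.-1] and keeps all others apart. *)
pose g (x : 'I_n) (b : bool) : nat :=
  if b then nat_of_bool (x == 0 :> nat) else if x == 0 :> nat then n.-1 else x.
have hg : hamming g (@adj (compl spider)).
  split=> [[u u_n] [v v_n] guv|[u u_n] [v v_n]].
    apply/val_inj; move: (guv true) (guv false); rewrite /g /=.
    by case: (u =P 0) => [->|_]; case: (v =P 0) => [->|_].
  rewrite conat_adjE /nat_corel /nat_rel /spider_edges /= => uv.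
  exists ((u == 0) || (v == 0)); apply/lineP => -[]; rewrite /g /=;
    by move: uv; case: (u =P 0) => [->|_]; case: (v =P 0) => [->|_]; lia.
apply: leq_trans (hamming_md spider_compl_connected hg).
rewrite -card_bool -cardsT; apply/subset_leq_card/subsetP => b _; rewrite inE.
apply/existsP; exists (ord0 : 'I_n); apply/existsP.
by exists (Ordinal (isT : 1 < n)); case: b.
Qed.

End Spider.

Lemma md_product_attained_spider n : 6 <= n -> md_product_attained n (2 * (n - 1)).
Proof.
move=> n6; have [m en] : exists m, n = m.+4 by exists (n - 4); lia.
have cn : #|spider m| = n by rewrite en card_nat_graph.
exists (spider m); split=> //; [exact: spider_connected|exact: spider_compl_connected|].
apply/eqP; rewrite eqn_leq; apply/andP; split.
  have := md_product_le _ (@spider_connected m) (@spider_compl_connected m).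
  by rewrite cn => /(_ ltac:(lia)); rewrite (maxn_idPr _) //; lia.
rewrite mulnC en subn1; exact: leq_mul (spider_md m) (spider_compl_md m).
Qed.

(** The spider of order 4 is the path on four vertices. *)
Lemma md_product_attained4 : md_product_attained 4 9.
Proof.
have con := @spider_connected 0; have con' := @spider_compl_connected 0.
have n4 : #|spider 0| = 4 := card_nat_graph _ _.
exists (spider 0); split=> //; apply/eqP; rewrite eqn_leq md_product_ge4 // andbT.
by apply: leq_trans (md_product_le _ con con') _; rewrite n4.
Qed.

(** * Graphs of order at least 7 with both numbers equal to 1 *)

Fixpoint grows (V : finType) (e : rel V) (K s : seq V) :=
  if s is v :: s' then [&& v \notin K, 1 < count (e v) K & grows e (v :: K) s'] else true.

Section Grow.
Variables (V I : finType) (X : eqType) (f : V -> I -> X) (e : rel V).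
Hypothesis hf : hamming f e.

Lemma line_add i x v (K : seq V) : uniq K -> {in K, forall y, line f i x y} ->
  1 < count (e v) K -> line f i x v.
Proof.
move=> uK lK; rewrite -size_filter; have := filter_uniq (e v) uK.
case E: [seq _ <- _ | _] => [|y [|z t]] //= /andP[+ _] _; rewrite inE => /norP[yz _].
have [yF zF] : y \in [seq u <- K | e v u] /\ z \in [seq u <- K | e v u].
  by rewrite E !inE !eqxx orbT.
move: yF zF; rewrite !mem_filter => /andP[vy /lK ly] /andP[vz /lK lz].
apply: line_trans (ly) _; rewrite line_sym; apply: (edge_two_line hf yz _ vy vz).
by apply: line_trans lz; rewrite line_sym.
Qed.

Lemma grows_line i x (K s : seq V) : uniq K -> {in K, forall y, line f i x y} ->
  grows e K s -> {in s ++ K, forall y, line f i x y}.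
Proof.
elim: s K => //= v s IH K uK lK /and3P[vK cK gs] y.
have lv := line_add uK lK cK.
have lK' : {in v :: K, forall y, line f i x y}.
  by move=> z; rewrite inE => /predU1P[->|/lK].
rewrite inE mem_cat => ys; apply: (IH (v :: K)) => //=; first by rewrite vK.
by rewrite mem_cat inE orbCA.
Qed.

End Grow.

Section Rigid.
Variable m : nat.
Let n := m.+4.+3.

(* The graph grows from the common line through [0] and [1] of the [K_{2,3}] on
   [{0, 1}] and [{2, 3, 4}], its complement from the triangle [2 3 4]: each
   further vertex has two neighbours already on the line. *)
Definition rigid_edges : rel nat := fun i j =>
  if 6 < j then i < 2
  else (i, j) \in [:: (0, 2); (0, 3); (0, 4); (1, 2); (1, 3); (1, 4);
                      (0, 5); (2, 5); (2, 6); (3, 6)].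
Definition rigid := nat_graph n rigid_edges.

Let v0 : 'I_n := @Ordinal n 0 isT.
Let v1 : 'I_n := @Ordinal n 1 isT.
Let v2 : 'I_n := @Ordinal n 2 isT.
Let v3 : 'I_n := @Ordinal n 3 isT.
Let v4 : 'I_n := @Ordinal n 4 isT.
Let v5 : 'I_n := @Ordinal n 5 isT.
Let v6 : 'I_n := @Ordinal n 6 isT.

Lemma rigid_cases (P : 'I_n -> Prop) :
    {in [:: v0; v1; v2; v3; v4; v5; v6], forall x, P x} ->
    (forall x : 'I_n, 6 < x -> P x) ->
  forall x, P x.
Proof.
move=> h hl x; have [|x6] := ltnP 6 x; first exact: hl.
apply: h; rewrite !inE -!val_eqE /=.
by case: (nat_of_ord x) x6 => [|[|[|[|[|[|[|k]]]]]]].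
Qed.

Lemma rigid_connected : connected rigid.
Proof.
apply: (nat_graph_connected (root := 0) (mu := nth 1 [:: 0; 2; 1; 1; 1; 1; 2])
  (par := nth 0 [:: 0; 2; 0; 0; 0; 0; 2])) => i i_n i0.
by case: i i_n i0 => [|[|[|[|[|[|[|k]]]]]]] // _ _; rewrite /= !nth_nil.
Qed.

Lemma rigid_compl_connected : connected (compl rigid).
Proof.
apply: (conat_graph_connected (root := 4) (mu := nth 1 [:: 2; 2; 1; 1; 0; 1; 1])
  (par := nth 4 [:: 6; 5; 4; 4; 4; 4; 4])) => i i_n i0.
by case: i i_n i0 => [|[|[|[|[|[|[|k]]]]]]] // _ _; rewrite /= !nth_nil.
Qed.

Lemma rigid_md : md rigid <= 1.
Proof.
have [I [f [hf <-]]] := md_hamming rigid_connected; have ei := @adj_irrefl rigid.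
have [i l01] : exists i, line f i v0 v1.
  by apply: (k23_line ei hf (a := v2) (b := v3) (c := v4)) => // x;
    rewrite !inE => /or3P[]/eqP->.
have l7 : {in [:: v2; v3; v4; v5; v6] ++ [:: v0; v1], forall y, line f i v0 y}.
  apply: (@grows_line _ _ _ f (@adj rigid)) => // y.
  by rewrite !inE => /orP[]/eqP->; rewrite ?line_refl.
apply: (agree_le (S := [:: i]) (x := v0)) => x; apply/agree_sym/(line_agree (mem_head _ _)).
move: x; apply: rigid_cases => x xs.
  by apply: l7; move: xs; rewrite !inE => /or4P[| | |/or4P[]] /eqP->; rewrite eqxx ?orbT.
apply: (line_add hf (K := [:: v0; v1])) => // [y|].
  by rewrite !inE => /orP[]/eqP->; rewrite ?line_refl.
(* Every vertex beyond [6] is adjacent to both [0] and [1]; on plain numbers this is decided by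
   computation. *)
change (1 < count (nat_rel rigid_edges x) [:: 0; 1]).
by case: (nat_of_ord x) xs => [|[|[|[|[|[|[|k]]]]]]].
Qed.

Lemma rigid_compl_md : md (compl rigid) <= 1.
Proof.
have [I [f [hf <-]]] := md_hamming rigid_compl_connected.
have ei := @adj_irrefl (compl rigid).
have [i [l23 l24]] : exists i, line f i v2 v3 /\ line f i v2 v4.
  by apply: (triangle_line ei hf).
have l7 : {in [:: v5; v6; v1; v0] ++ [:: v2; v3; v4], forall y, line f i v2 y}.
  apply: (@grows_line _ _ _ f (@adj (compl rigid))) => // y.
  by rewrite !inE => /or3P[]/eqP->; rewrite ?line_refl.
apply: (agree_le (S := [:: i]) (x := v2)) => x; apply/agree_sym/(line_agree (mem_head _ _)).
move: x; apply: rigid_cases => x xs.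
  by apply: l7; move: xs; rewrite !inE => /or4P[| | |/or4P[]] /eqP->; rewrite eqxx ?orbT.
apply: (line_add hf (K := [:: v2; v3; v4])) => // [y|].
  by rewrite !inE => /or3P[]/eqP->; rewrite ?line_refl.
change (1 < count (nat_corel rigid_edges x) [:: 2; 3; 4]).
by case: (nat_of_ord x) xs => [|[|[|[|[|[|[|k]]]]]]].
Qed.

End Rigid.

Lemma md_product_attained_rigid n : 6 < n -> md_product_attained n 1.
Proof.
move=> n6; have [m en] : exists m, n = m.+4.+3 by exists (n - 7); lia.
have [con con'] := (@rigid_connected m, @rigid_compl_connected m).
have cn : #|rigid m| = n by rewrite en card_nat_graph.
have g1 : 1 < #|rigid m| by rewrite cn; lia.
exists (rigid m); split=> //; apply/eqP; rewrite eqn_leq muln_gt0.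
rewrite (md_gt0 g1 con) (@md_gt0 (compl (rigid m)) g1 con') !andbT.
by apply: leq_trans (leq_mul (rigid_md m) (rigid_compl_md m)) _.
Qed.

Theorem theorem4p4 (n : nat) (hn : 4 <= n) :
  (forall G : sgraph, #|G| = n -> connected G -> connected (compl G) ->
     [/\ n = 4 -> md G * md (compl G) = 9,
         n = 5 -> 4 <= md G * md (compl G) <= 9,
         n = 6 -> 3 <= md G * md (compl G) <= 10
       & 7 <= n -> 1 <= md G * md (compl G) <= 2 * (n - 1)])
  /\
  [/\ n = 4 -> md_product_attained n 9,
      n = 5 -> md_product_attained n 4 /\ md_product_attained n 9,
      n = 6 -> md_product_attained n 3 /\ md_product_attained n 10
    & 7 <= n -> md_product_attained n 1 /\ md_product_attained n (2 * (n - 1))].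
Proof.
split=> [G Gn con con'|].
  have G4 : 3 < #|G| by rewrite Gn.
  have g1 : 1 < #|G| by apply: leq_trans G4.
  have := md_product_le G4 con con'; rewrite Gn => up.
  split=> en; try rewrite en in Gn up.
  - by apply/eqP; rewrite eqn_leq up md_product_ge4.
  - by rewrite md_product_ge5.
  - by rewrite md_product_ge6.
  rewrite muln_gt0 md_gt0 // (@md_gt0 (compl G) g1 con') /=.
  by apply: leq_trans up _; rewrite geq_max leqnn andbT; move: en; clear; lia.
split=> [->|->|->|n7].
- exact: md_product_attained4.
- by split; [exact: md_product_attained5_4 | exact: md_product_attained5_9].
- by split; [exact: md_product_attained6_3 | exact: (@md_product_attained_spider 6)].
split; first exact: md_product_attained_rigid.
by apply: md_product_attained_spider; apply: leq_trans n7.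
Qed.
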